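(* Let $n\ge 3$, let $R=\Pi_{\widetilde{A_{n-1}}}$, and let $F$ be the set of graded algebra automorphisms $\sigma$ of $R$ of finite order with $\sigma(e_i)=e_i$ for all $i=0,\dots,n-1$. Let $\sigma\in F$ with $m=|\sigma|$, $1<m<\infty$, and let $G=\langle\sigma\rangle$. Write $\sigma(\alpha_i)=\xi_i\alpha_i$ and $\sigma(\alpha_i^* )=\xi_i^*\alpha_i^*$ with $\xi_i,\xi_i^*\in\Bbbk^\times$ for $i=0,\dots,n-1$, and suppose $\xi_1\xi_1^*=1$. In each of the following cases, the Auslander map $\eta_{R,G}:R\#G\to\mathrm{End}_{R^G}R$ is an isomorphism. \begin{enumerate} \item There is some primitive $m$th root of unity $\zeta$ such that $\xi_i=\zeta$ for $i=0,\dots,n-1$. \item There is some primitive $m$th root of unity $\zeta$ such that $\xi_0\xi_1\cdots\xi_{n-1}=\zeta$. \item For all $i,j=0,\dots,n-1$ with $i\neq j$, we have $\gcd(|\xi_i|,|\xi_j|)=1$, where $|\xi_i|$ denotes the multiplicative order of the root of unity $\xi_i$. \end{enumerate}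
   Context: $\Bbbk$ is an algebraically closed field of characteristic zero. Preprojective algebra: for $n\geq 3$, let $\overline{Q}$ be the quiver with vertices $e_0,\dots,e_{n-1}$ and, for each $i=0,\dots,n-1$ (all indices mod $n$), one nonstar arrow $\alpha_i$ from $e_i$ to $e_{i+1}$ and one star arrow $\alpha_i^*$ from $e_{i+1}$ to $e_i$. In the path algebra $\Bbbk\overline{Q}$, paths are composed left to right and the $e_i$ are the trivial paths. Set $\Omega=\sum_{i=0}^{n-1}(\alpha_i\alpha_i^*-\alpha_i^*\alpha_i)$ and $R=\Pi_{\widetilde{A_{n-1}}}=\Bbbk\overline{Q}/(\Omega)$, graded by path length. A graded automorphism is an algebra automorphism preserving each graded piece. For $\sigma\in F$, each arrow is sent to a nonzero scalar multiple of itself, the scalars $\xi_i,\xi_i^*$ are roots of unity, and the product $\xi_i\xi_i^*$ is independent of $i$. Auslander map: for an algebra $R$ and a finite group $G$ of automorphisms of $R$, the skew group ring $R\#G$ consists of formal sums $\sum_{g\in G} a_g\#g$ with $a_g\in R$ and multiplication $(a\#g)(b\#h)=a\,g(b)\#gh$. $R^G$ is the fixed ring, $R$ is regarded as a right $R^G$-module, and $\eta_{R,G}:R\#G\to\mathrm{End}_{R^G}R$ sends $a\#g$ to the endomorphism $b\mapsto a\,g(b)$. *)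

(* Defs.v *)
From HB Require Import structures.
From mathcomp Require Import all_boot all_order all_algebra.
From mathcomp Require Import finmap.
From mathcomp Require Import boolp.
From mathcomp.multinomials Require Import monalg.

Set Implicit Arguments.
Unset Strict Implicit.
Unset Printing Implicit Defensive.

Import GRing.Theory.

Local Open Scope ring_scope.

(* Least d > 0 with P d, and 0 if there is none (infinite order). *)
Definition least_pos (P : pred nat) : nat :=
  if pselect (exists d, (0 < d)%N && P d) is left exP then ex_minn exP else 0%N.

Lemma least_posP (P : pred nat) : (exists d, (0 < d)%N && P d) ->
  [/\ (0 < least_pos P)%N, P (least_pos P)
    & forall d, (0 < d)%N -> P d -> (least_pos P <= d)%N].
Proof.
move=> exP; rewrite /least_pos; case: pselect => // exP'.
case: ex_minnP => d /andP[d0 Pd] dmin; split=> // j j0 Pj.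
by apply: dmin; rewrite j0.
Qed.

Definition root_order (k : fieldType) (z : k) : nat :=
  least_pos (fun d => z ^+ d == 1).

Section GroupElements.
Local Open Scope group_scope.
Variable gT : groupType.
Implicit Types x y : gT.

Definition group_order x : nat := least_pos (fun d => x ^+ d == 1).

Definition finite_order x : Prop := exists d, (0 < d)%N && (x ^+ d == 1).

Record finSubgroup := FinSubgroup {
  fsg_set :> {fset gT};
  fsg1 : 1 \in fsg_set;
  fsgM : forall x y, x \in fsg_set -> y \in fsg_set -> x * y \in fsg_set;
  fsgV : forall x, x \in fsg_set -> x^-1 \in fsg_set }.

Section Cycle.
Variables (x : gT) (fin_x : finite_order x).

Definition cycle_fset : {fset gT} :=
  [fset x ^+ (i : 'I_(group_order x)) | i in 'I_(group_order x)]%fset.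

Lemma cycle_fsetX d : x ^+ d \in cycle_fset.
Proof.
have [o0 /eqP xo _] := least_posP fin_x.
rewrite (divn_eq d (group_order x)) mulnC expgnDr expgnA xo expg1n mul1g.
apply/imfsetP; exists (Ordinal (ltn_pmod d o0)) => //.
Qed.

Lemma cycle_fsetP y : reflect (exists d, y = x ^+ d) (y \in cycle_fset).
Proof.
apply: (iffP idP) => [/imfsetP[i _ ->]|[d ->]]; last exact: cycle_fsetX.
by exists i.
Qed.

Fact cycle_fset1 : 1 \in cycle_fset.
Proof. exact: (cycle_fsetX 0). Qed.

Fact cycle_fsetM y z :
  y \in cycle_fset -> z \in cycle_fset -> y * z \in cycle_fset.
Proof.
by move=> /cycle_fsetP[i ->] /cycle_fsetP[j ->]; rewrite -expgnDr cycle_fsetX.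
Qed.

Fact cycle_fsetV y : y \in cycle_fset -> y^-1 \in cycle_fset.
Proof.
move=> /imfsetP[i _ ->].
have [o0 /eqP xo _] := least_posP fin_x.
suff -> : (x ^+ i)^-1 = x ^+ (group_order x - i) by exact: cycle_fsetX.
apply: (mulgI (x ^+ i)); rewrite mulgV -expgnDr subnKC ?(ltnW (ltn_ord i)) //.
Qed.

Definition cycle_group : finSubgroup :=
  FinSubgroup cycle_fset1 cycle_fsetM cycle_fsetV.

End Cycle.
End GroupElements.

Section AlgAut.
Variables (k : fieldType) (A : algType k).

Definition is_algAut (f : A -> A) : Prop :=
  [/\ linear f, monoid_morphism f & bijective f].

Record algAut := AlgAut { aut_fun :> A -> A; _ : `[< is_algAut aut_fun >] }.

HB.instance Definition _ := [isSub for aut_fun].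
HB.instance Definition _ := [Choice of algAut by <:].

Implicit Types f g h : algAut.

Lemma algAutP f : is_algAut f.
Proof. by case: f => f fP; apply/asboolP. Qed.

Lemma algAut_eq f g : f =1 g -> f = g.
Proof. by move=> fg; apply/val_inj/funext. Qed.

HB.instance Definition _ f :=
  GRing.isLinear.Build k A A _ (aut_fun f) (let: And3 l _ _ := algAutP f in l).
HB.instance Definition _ f :=
  GRing.isMonoidMorphism.Build A A (aut_fun f)
    (let: And3 _ m _ := algAutP f in m).

Lemma algAut_bij f : bijective f. Proof. by case: (algAutP f). Qed.

Fact algAut1_subproof : is_algAut (@id A).
Proof. by split; [|split|exists id]. Qed.
Definition algAut1 := AlgAut (asboolT algAut1_subproof).

Fact algAutM_subproof f g : is_algAut (fun x => f (g x)).
Proof.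
split; first by move=> a x y; rewrite !linearP.
  by split=> [|x y]; rewrite ?rmorph1 ?rmorphM.
exact: bij_comp (algAut_bij f) (algAut_bij g).
Qed.
Definition algAutM f g := AlgAut (asboolT (algAutM_subproof f g)).

Fact algAutV_subproof f :
  exists g : algAut, cancel f g /\ cancel g f.
Proof.
have [g fK gK] := algAut_bij f.
suff gP : is_algAut g by exists (AlgAut (asboolT gP)).
split; last by exists f.
  by move=> a x y; apply: (can_inj fK); rewrite linearP /= !gK.
by split=> [|x y]; apply: (can_inj fK); rewrite ?rmorph1 ?rmorphM /= !gK.
Qed.
Definition algAutV f := projT1 (cid (algAutV_subproof f)).

Lemma algAutVK f : cancel f (algAutV f) /\ cancel (algAutV f) f.
Proof. exact: projT2 (cid (algAutV_subproof f)). Qed.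

Fact algAut_mulA : associative algAutM.
Proof. by move=> f g h; apply: algAut_eq. Qed.
Fact algAut_mul1 : left_id algAut1 algAutM.
Proof. by move=> f; apply: algAut_eq. Qed.
Fact algAut_1mul : right_id algAut1 algAutM.
Proof. by move=> f; apply: algAut_eq. Qed.
Fact algAut_mulV : left_inverse algAut1 algAutV algAutM.
Proof. by move=> f; apply: algAut_eq => x /=; case: (algAutVK f) => ->. Qed.
Fact algAut_Vmul : right_inverse algAut1 algAutV algAutM.
Proof. by move=> f; apply: algAut_eq => x /=; case: (algAutVK f) => _ ->. Qed.

HB.instance Definition _ := isGroup.Build algAut
  algAut_mulA algAut_mul1 algAut_1mul algAut_mulV algAut_Vmul.

Lemma algAut1E x : (1%g : algAut) x = x. Proof. by []. Qed.
Lemma algAutME f g x : (f * g)%g x = f (g x). Proof. by []. Qed.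

End AlgAut.

Section Auslander.
Variables (k : fieldType) (A : algType k) (G : finSubgroup (algAut A)).

Definition fixed_ring : {pred A} := [pred x | [forall g : G, val g x == x]].

Lemma fixed_ringP x :
  reflect (forall g : algAut A, g \in fsg_set G -> g x = x) (x \in fixed_ring).
Proof.
apply: (iffP forallP) => [fx g Gg|fx g]; first exact/eqP/(fx [` Gg]%fset).
by apply/eqP/fx/(valP g).
Qed.

(* The formal sum of the a g # g is the function g |-> a g. *)
Definition skew_ring : Type := {ffun G -> A}.
HB.instance Definition _ := GRing.Zmodule.on skew_ring.

Implicit Types u v w : skew_ring.

Definition skew_elt (a : A) (g : G) : skew_ring :=
  [ffun x => if x == g then a else 0].

Definition fsg_one : G := [` fsg1 G]%fset.

Definition skew_one : skew_ring := skew_elt 1 fsg_one.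

Definition skew_mul u v : skew_ring :=
  [ffun x => \sum_(g : G) \sum_(h : G | (val g * val h)%g == val x)
               u g * val g (v h)].

Let Gmul (g h : G) : G := [` fsgM (valP g) (valP h)]%fset.
Let GV (g : G) : G := [` fsgV (valP g)]%fset.

Let skew_sum (x g : G) (F : G -> A) :
  \sum_(h : G | (val g * val h)%g == val x) F h = F (Gmul (GV g) x).
Proof.
rewrite (big_pred1 (Gmul (GV g) x)) // => h /=.
apply/eqP/eqP => [e|-> /=]; last by rewrite mulVKg.
by apply: val_inj; rewrite /= -e mulKg.
Qed.

Lemma skew_mulE u v (x : G) :
  skew_mul u v x = \sum_(g : G) u g * val g (v (Gmul (GV g) x)).
Proof. by rewrite ffunE; apply: eq_bigr => g _; rewrite skew_sum. Qed.

Fact skew_mulA : associative skew_mul.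
Proof.
move=> u v w; apply/ffunP => x; rewrite !skew_mulE.
under eq_bigr => g _ do rewrite skew_mulE raddf_sum mulr_sumr.
under [RHS]eq_bigr => g _ do rewrite skew_mulE mulr_suml.
rewrite [RHS]exchange_big /=; apply: eq_bigr => a _.
rewrite (reindex (Gmul (GV a))) /=; last first.
  by exists (Gmul a) => g _; apply: val_inj; rewrite /= ?mulVKg ?mulKg.
apply: eq_bigr => g _; rewrite rmorphM mulrA; congr (_ * _).
have aK y : fsval a ((fsval a)^-1%g y) = y.
  by rewrite -[LHS]algAutME mulgV.
rewrite [LHS]aK; congr (fsval g (w _)).
by apply: val_inj; rewrite /= invgM invgK -mulgA mulVKg.
Qed.

Fact skew_mul1 : left_id skew_one skew_mul.
Proof.
move=> u; apply/ffunP => x; rewrite skew_mulE (bigD1 fsg_one) //=.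
rewrite big1 => [|g /negPf ng]; last by rewrite ffunE ng mul0r.
rewrite ffunE eqxx mul1r addr0; congr (u _).
by apply: val_inj; rewrite /= invg1 mul1g.
Qed.

Fact skew_1mul : right_id skew_one skew_mul.
Proof.
move=> u; apply/ffunP => x; rewrite skew_mulE (bigD1 x) //=.
rewrite big1 => [|g ng]; rewrite ffunE.
  rewrite (_ : Gmul _ _ = fsg_one) ?eqxx ?rmorph1 ?mulr1 ?addr0 //.
  by apply: val_inj; rewrite /= mulVg.
case: eqP => [e|_]; last by rewrite raddf0 mulr0.
case/eqP: ng; apply: val_inj; move/(congr1 val): e => /= e.
by rewrite -[val x](mulVKg (val g)) e mulg1.
Qed.

Fact skew_mulDl : left_distributive skew_mul +%R.
Proof.
move=> u v w; apply/ffunP => x; rewrite !(skew_mulE, ffunE) -big_split /=.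
by apply: eq_bigr => g _; rewrite ffunE mulrDl.
Qed.

Fact skew_mulDr : right_distributive skew_mul +%R.
Proof.
move=> u v w; apply/ffunP => x; rewrite !(skew_mulE, ffunE) -big_split /=.
by apply: eq_bigr => g _; rewrite ffunE raddfD mulrDr.
Qed.

HB.instance Definition _ := GRing.Zmodule_isPzRing.Build skew_ring
  skew_mulA skew_mul1 skew_1mul skew_mulDl skew_mulDr.

Lemma skew_eltM a b (g h gh : G) : (val g * val h)%g = val gh ->
  skew_elt a g * skew_elt b h = skew_elt (a * val g b) gh.
Proof.
move=> e; apply/ffunP => x; rewrite [LHS]ffunE (bigD1 g) //= addrC big1.
  rewrite add0r skew_sum !ffunE eqxx.
  have -> : (Gmul (GV g) x == h) = (x == gh).
    apply/eqP/eqP => [eh|->]; apply: val_inj.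
      by rewrite -e -eh /= mulVKg.
    by rewrite /= -e mulKg.
  by case: eqP => // _; rewrite raddf0 mulr0.
by move=> i /negPf ni; rewrite big1 // => j _; rewrite ffunE ni mul0r.
Qed.

(* End_{R^G}(R), for R a right module over its subring R^G. *)
Definition is_fixed_endo (f : A -> A) : Prop :=
  zmod_morphism f /\ (forall b c, c \in fixed_ring -> f (b * c) = f b * c).

Record fixed_endo :=
  FixedEndo { endo_fun :> A -> A; _ : `[< is_fixed_endo endo_fun >] }.

HB.instance Definition _ := [isSub for endo_fun].
HB.instance Definition _ := [Choice of fixed_endo by <:].

Implicit Types p q r : fixed_endo.

Lemma fixed_endoP p : is_fixed_endo p.
Proof. by case: p => f fP; apply/asboolP. Qed.

Lemma fixed_endo_eq p q : p =1 q -> p = q.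
Proof. by move=> pq; apply/val_inj/funext. Qed.

HB.instance Definition _ p :=
  GRing.isZmodMorphism.Build A A (endo_fun p) (fixed_endoP p).1.

Lemma fixed_endoM p b c : c \in fixed_ring -> p (b * c) = p b * c.
Proof. exact: (fixed_endoP p).2. Qed.

Fact endo0_subproof : is_fixed_endo (fun=> 0).
Proof. by split=> [x y|b c _]; rewrite ?subrr ?mul0r. Qed.
Fact endoN_subproof p : is_fixed_endo (fun x => - p x).
Proof.
split=> [x y|b c cG]; first by rewrite raddfB opprB opprK addrC.
by rewrite fixed_endoM // mulNr.
Qed.
Fact endoD_subproof p q : is_fixed_endo (fun x => p x + q x).
Proof.
split=> [x y|b c cG]; first by rewrite !raddfB opprD addrACA.
by rewrite !fixed_endoM // mulrDl.
Qed.
Fact endo1_subproof : is_fixed_endo id.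
Proof. by []. Qed.
Fact endoM_subproof p q : is_fixed_endo (fun x => p (q x)).
Proof.
by split=> [x y|b c cG]; [rewrite !raddfB|rewrite !fixed_endoM].
Qed.

Definition endo0 := FixedEndo (asboolT endo0_subproof).
Definition endoN p := FixedEndo (asboolT (endoN_subproof p)).
Definition endoD p q := FixedEndo (asboolT (endoD_subproof p q)).
Definition endo1 := FixedEndo (asboolT endo1_subproof).
Definition endoM p q := FixedEndo (asboolT (endoM_subproof p q)).

Fact endoDA : associative endoD.
Proof. by move=> p q r; apply: fixed_endo_eq => x /=; rewrite addrA. Qed.
Fact endoDC : commutative endoD.
Proof. by move=> p q; apply: fixed_endo_eq => x /=; rewrite addrC. Qed.
Fact endo0D : left_id endo0 endoD.
Proof. by move=> p; apply: fixed_endo_eq => x /=; rewrite add0r. Qed.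
Fact endoND : left_inverse endo0 endoN endoD.
Proof. by move=> p; apply: fixed_endo_eq => x /=; rewrite addNr. Qed.

HB.instance Definition _ :=
  GRing.isZmodule.Build fixed_endo endoDA endoDC endo0D endoND.

Fact endoMA : associative endoM.
Proof. by move=> p q r; apply: fixed_endo_eq. Qed.
Fact endo1M : left_id endo1 endoM.
Proof. by move=> p; apply: fixed_endo_eq. Qed.
Fact endoM1 : right_id endo1 endoM.
Proof. by move=> p; apply: fixed_endo_eq. Qed.
Fact endoMDl : left_distributive endoM +%R.
Proof. by move=> p q r; apply: fixed_endo_eq. Qed.
Fact endoMDr : right_distributive endoM +%R.
Proof. by move=> p q r; apply: fixed_endo_eq => x /=; rewrite raddfD. Qed.

HB.instance Definition _ := GRing.Zmodule_isPzRing.Build fixed_endo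
  endoMA endo1M endoM1 endoMDl endoMDr.

Lemma endoDE p q x : (p + q) x = p x + q x. Proof. by []. Qed.
Lemma endoNE p x : (- p) x = - p x. Proof. by []. Qed.
Lemma endoME p q x : (p * q) x = p (q x). Proof. by []. Qed.
Lemma endo1E x : (1 : fixed_endo) x = x. Proof. by []. Qed.

Definition auslander_fun u (b : A) : A := \sum_(g : G) u g * val g b.

Fact auslander_subproof u : is_fixed_endo (auslander_fun u).
Proof.
split=> [x y|b c /fixed_ringP cG]; rewrite /auslander_fun.
  by rewrite -sumrB; apply: eq_bigr => g _; rewrite raddfB mulrBr.
rewrite mulr_suml; apply: eq_bigr => g _.
by rewrite rmorphM /= (cG (fsval g)) ?mulrA ?(valP g).
Qed.

Definition auslander u : fixed_endo :=
  FixedEndo (asboolT (auslander_subproof u)).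

Lemma auslander_elt a g b : auslander (skew_elt a g) b = a * val g b.
Proof.
rewrite /= /auslander_fun (bigD1 g) //= big1 => [|h /negPf nh].
  by rewrite ffunE eqxx addr0.
by rewrite ffunE nh mul0r.
Qed.

Fact auslander_zmod_morphism : zmod_morphism auslander.
Proof.
move=> u v; apply: fixed_endo_eq => b /=.
rewrite /auslander_fun -sumrB; apply: eq_bigr => g _.
by rewrite !ffunE mulrBl.
Qed.

Fact auslander_monoid_morphism : monoid_morphism auslander.
Proof.
split=> [|u v]; apply: fixed_endo_eq => b.
  by rewrite auslander_elt mul1r.
rewrite /= /auslander_fun.
under eq_bigr => x _ do rewrite skew_mulE mulr_suml.
rewrite exchange_big /=; apply: eq_bigr => g _.
rewrite raddf_sum mulr_sumr.
rewrite (reindex (Gmul g)) /=; last first.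
  by exists (Gmul (GV g)) => h _; apply: val_inj; rewrite /= ?mulVKg ?mulKg.
apply: eq_bigr => h _; rewrite rmorphM mulrA; congr (_ * val g (v _) * _).
by apply: val_inj; rewrite /= mulKg.
Qed.

HB.instance Definition _ := GRing.isZmodMorphism.Build skew_ring fixed_endo
  auslander auslander_zmod_morphism.
HB.instance Definition _ := GRing.isMonoidMorphism.Build skew_ring fixed_endo
  auslander auslander_monoid_morphism.

End Auslander.

Arguments auslander {k A} G u.

(* Vertices are required to exist so that path algebras satisfy 1 != 0. *)
Record quiver := Quiver {
  qvert : finType;
  qarr : finType;
  qsrc : qarr -> qvert;
  qtgt : qarr -> qvert;
  qvert_gt0 : (0 < #|qvert|)%N }.

Section Paths.
Variable Q : quiver.

Fixpoint is_qpath (v : qvert Q) (s : seq (qarr Q)) : bool :=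
  if s is a :: s' then (qsrc a == v) && is_qpath (qtgt a) s' else true.

Definition qpath_end (v : qvert Q) (s : seq (qarr Q)) : qvert Q :=
  last v [seq qtgt a | a <- s].

(* A path is its start vertex together with its successive arrows. *)
Record qpath := QPath {
  qpath_val : qvert Q * seq (qarr Q);
  _ : is_qpath qpath_val.1 qpath_val.2 }.

HB.instance Definition _ := [isSub for qpath_val].
HB.instance Definition _ := [Countable of qpath by <:].

Implicit Types p q r : qpath.

Definition qstart p : qvert Q := (val p).1.
Definition qarrows p : seq (qarr Q) := (val p).2.
Definition qend p : qvert Q := qpath_end (qstart p) (qarrows p).
Definition qlength p : nat := size (qarrows p).

Definition qtriv (v : qvert Q) : qpath := @QPath (v, [::]) isT.

Fact qpath_arrow_subproof (a : qarr Q) : is_qpath (qsrc a) [:: a].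
Proof. by rewrite /= eqxx. Qed.
Definition qpath_arrow (a : qarr Q) : qpath :=
  @QPath (qsrc a, [:: a]) (qpath_arrow_subproof a).

(* First p, then q. When the endpoints match, insub always succeeds: see
   qconcatP. *)
Definition qconcat p q : option qpath :=
  if qend p == qstart q then insub (qstart p, qarrows p ++ qarrows q)
  else None.

Lemma qpath_eq p q : qstart p = qstart q -> qarrows p = qarrows q -> p = q.
Proof.
move=> e1 e2; apply: val_inj; rewrite /qstart /qarrows in e1 e2.
by rewrite [LHS]surjective_pairing e1 e2 -surjective_pairing.
Qed.

Lemma is_qpath_cat v s t :
  is_qpath v (s ++ t) = is_qpath v s && is_qpath (qpath_end v s) t.
Proof. by elim: s v => //= a s IHs v; rewrite IHs andbA. Qed.

Lemma qpath_end_cat v s t :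
  qpath_end v (s ++ t) = qpath_end (qpath_end v s) t.
Proof. by rewrite /qpath_end map_cat last_cat. Qed.

Variant qconcat_spec p q : option qpath -> bool -> Prop :=
| QConcatSome r of qend p = qstart q & qstart r = qstart p
    & qarrows r = qarrows p ++ qarrows q & qend r = qend q :
    qconcat_spec p q (Some r) true
| QConcatNone of qend p != qstart q : qconcat_spec p q None false.

Lemma qconcatP p q : qconcat_spec p q (qconcat p q) (qend p == qstart q).
Proof.
rewrite /qconcat; case: eqP => [e|/eqP ne]; last by constructor.
case: insubP => [r _ rE|].
  have rs : qstart r = qstart p by rewrite /qstart rE.
  have ra : qarrows r = qarrows p ++ qarrows q by rewrite /qarrows rE.
  by constructor => //; rewrite /qend rs ra qpath_end_cat -/(qend p) e.
rewrite /= is_qpath_cat -/(qend p) e.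
by rewrite (valP p : is_qpath (qstart p) _) (valP q : is_qpath (qstart q) _).
Qed.

Lemma qconcatA p q r :
  obind (fun s => qconcat s r) (qconcat p q)
  = obind (qconcat p) (qconcat q r).
Proof.
case: (qconcatP p q) => [s epq ss sa se|npq] /=.
  case: (qconcatP q r) => [t eqr ts ta te|nqr] /=.
    case: (qconcatP s r) => [u _ us ua _|]; last by rewrite se eqr eqxx.
    case: (qconcatP p t) => [w _ ws wa _|]; last by rewrite ts epq eqxx.
    by congr Some; apply: qpath_eq; rewrite ?us ?ws // ua wa sa ta catA.
  by case: (qconcatP s r) => // u e; case/eqP: nqr; rewrite -se.
case: (qconcatP q r) => [t eqr ts ta te|//] /=.
by case: (qconcatP p t) => // w e; case/eqP: npq; rewrite e ts.
Qed.

Lemma qconcat_trivl v p :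
  qconcat (qtriv v) p = if v == qstart p then Some p else None.
Proof.
have -> : (v == qstart p) = (qend (qtriv v) == qstart p) by [].
case: (qconcatP (qtriv v) p) => // r e rs ra _; congr Some.
by apply: qpath_eq; rewrite ?rs ?ra -?e.
Qed.

Lemma qconcat_trivr v p :
  qconcat p (qtriv v) = if v == qend p then Some p else None.
Proof.
rewrite eq_sym; have -> : (qend p == v) = (qend p == qstart (qtriv v)) by [].
case: (qconcatP p (qtriv v)) => // r e rs ra _; congr Some.
by apply: qpath_eq; rewrite ?rs ?ra ?cats0.
Qed.

End Paths.

Definition path_alg (k : fieldType) (Q : quiver) : Type := {malg k[qpath Q]}.
HB.instance Definition _ (k : fieldType) (Q : quiver) :=
  GRing.Lmodule.on (path_alg k Q).

(* pbasis and path_mul are locked because comparing their unfoldings is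
   expensive. *)
HB.lock Definition pbasis (k : fieldType) (Q : quiver) (p : qpath Q) :
  path_alg k Q := << p >>.

Definition pbasis_mul (k : fieldType) (Q : quiver) (p q : qpath Q) :
    path_alg k Q :=
  if qconcat p q is Some r then pbasis k r else 0.

HB.lock Definition path_mul (k : fieldType) (Q : quiver) (f g : path_alg k Q) :
    path_alg k Q :=
  \sum_(p <- msupp f) \sum_(q <- msupp g) (f@_p * g@_q) *: pbasis_mul k p q.

Section PathAlgebra.
Variables (k : fieldType) (Q : quiver).
Local Notation path_alg := (path_alg k Q).
Local Notation pbasis := (@pbasis k Q).
Local Notation pbasis_mul := (@pbasis_mul k Q).
Local Notation path_mul := (@path_mul k Q).
Implicit Types (f g h : path_alg) (p q r : qpath Q).

Definition ptriv (v : qvert Q) : path_alg := pbasis (qtriv v).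
Definition parrow (a : qarr Q) : path_alg := pbasis (qpath_arrow a).

Definition path_one : path_alg := \sum_(v : qvert Q) ptriv v.

Lemma mcoeff_pbasis p q : (pbasis p)@_q = (p == q)%:R.
Proof. by rewrite pbasis.unlock mcoeffU. Qed.

Lemma path_mulE f g : path_mul f g =
  \sum_(p <- msupp f) \sum_(q <- msupp g) (f@_p * g@_q) *: pbasis_mul p q.
Proof. by rewrite path_mul.unlock. Qed.

Lemma pbasisE f : f = \sum_(p <- msupp f) f@_p *: pbasis p.
Proof.
rewrite [LHS]monalgE; apply: eq_bigr => p _; apply/malgP => q.
by rewrite mcoeffZ mcoeff_pbasis mcoeffU mulr_natr.
Qed.

Lemma path_mulEw (d1 d2 : {fset qpath Q}) f g :
  (msupp f `<=` d1)%fset -> (msupp g `<=` d2)%fset ->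
  path_mul f g = \sum_(p <- d1) \sum_(q <- d2) (f@_p * g@_q) *: pbasis_mul p q.
Proof.
move=> le1 le2; rewrite path_mulE (big_fset_incl _ le1) /=.
  apply/eq_bigr=> p _; apply/big_fset_incl => // q _ /mcoeff_outdom ->.
  by rewrite mulr0 scale0r.
move=> p _ /mcoeff_outdom fp; rewrite big1 // => q _.
by rewrite fp mul0r scale0r.
Qed.

Fact path_mulDl : left_distributive path_mul +%R.
Proof.
move=> f g h.
rewrite (path_mulEw (msuppD_le _ _) (fsubset_refl (msupp h))).
rewrite (path_mulEw (fsubsetUl _ (msupp g)) (fsubset_refl (msupp h))).
rewrite (path_mulEw (fsubsetUr (msupp f) _) (fsubset_refl (msupp h))).
rewrite -big_split /=; apply/eq_bigr => p _.
rewrite -big_split /=; apply/eq_bigr => q _.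
by rewrite mcoeffD mulrDl scalerDl.
Qed.

Fact path_mulDr : right_distributive path_mul +%R.
Proof.
move=> h f g.
rewrite (path_mulEw (fsubset_refl (msupp h)) (msuppD_le _ _)).
rewrite (path_mulEw (fsubset_refl (msupp h)) (fsubsetUl _ (msupp g))).
rewrite (path_mulEw (fsubset_refl (msupp h)) (fsubsetUr (msupp f) _)).
rewrite -big_split /=; apply/eq_bigr => p _.
rewrite -big_split /=; apply/eq_bigr => q _.
by rewrite mcoeffD mulrDr scalerDl.
Qed.

Lemma path_mulZl c f g : path_mul (c *: f) g = c *: path_mul f g.
Proof.
rewrite (path_mulEw (msuppZ_le _ _) (fsubset_refl (msupp g))).
rewrite path_mulE scaler_sumr; apply: eq_bigr => p _.
rewrite scaler_sumr; apply: eq_bigr => q _.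
by rewrite scalerA mcoeffZ mulrA.
Qed.

Lemma path_mulZr c f g : path_mul f (c *: g) = c *: path_mul f g.
Proof.
rewrite (path_mulEw (fsubset_refl (msupp f)) (msuppZ_le _ _)).
rewrite path_mulE scaler_sumr; apply: eq_bigr => p _.
rewrite scaler_sumr; apply: eq_bigr => q _.
by rewrite scalerA mcoeffZ mulrCA.
Qed.

Lemma path_mul0l g : path_mul 0 g = 0.
Proof. by rewrite path_mulE msupp0 big_seq_fset0. Qed.

Lemma path_mul0r f : path_mul f 0 = 0.
Proof.
by rewrite path_mulE; apply: big1 => p _; rewrite msupp0 big_seq_fset0.
Qed.

Lemma path_mul_suml (I : Type) (s : seq I) (F : I -> path_alg) g :
  path_mul (\sum_(i <- s) F i) g = \sum_(i <- s) path_mul (F i) g.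
Proof.
exact: (big_morph (path_mul^~ g) (fun x y => path_mulDl x y g) (path_mul0l g)).
Qed.

Lemma path_mul_sumr (I : Type) (s : seq I) (F : I -> path_alg) f :
  path_mul f (\sum_(i <- s) F i) = \sum_(i <- s) path_mul f (F i).
Proof. exact: (big_morph (path_mul f) (path_mulDr f) (path_mul0r f)). Qed.

Lemma path_mul_basis p q : path_mul (pbasis p) (pbasis q) = pbasis_mul p q.
Proof.
rewrite pbasis.unlock (path_mulEw (msuppU_le (k := p)) (msuppU_le (k := q))).
rewrite big_seq_fset1 big_seq_fset1.
by rewrite !mcoeffUU mulr1 scale1r.
Qed.

Fact path_mulA_basis p q r :
  path_mul (pbasis p) (pbasis_mul q r) = path_mul (pbasis_mul p q) (pbasis r).
Proof.
have := qconcatA p q r; rewrite /pbasis_mul.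
case: (qconcat p q) => [s|]; case: (qconcat q r) => [t|] e.
- by rewrite 2!path_mul_basis /pbasis_mul [qconcat s r]e.
- by rewrite path_mul0r path_mul_basis /pbasis_mul [qconcat s r]e.
- by rewrite path_mul0l path_mul_basis /pbasis_mul -[qconcat p t]e.
- by rewrite path_mul0l path_mul0r.
Qed.

Lemma path_alg_ind (P : path_alg -> Prop) :
  P 0 -> (forall f g, P f -> P g -> P (f + g)) ->
  (forall c f, P f -> P (c *: f)) -> (forall p, P (pbasis p)) -> forall f, P f.
Proof.
move=> P0 PD PZ Pb f; rewrite [f]pbasisE.
by elim/big_ind: _ => // p _; apply: PZ; apply: Pb.
Qed.

Fact path_mulA : associative path_mul.
Proof.
move=> f g h; elim/path_alg_ind: f => [|f f' IH IH'|c f IH|p].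
- by rewrite !path_mul0l.
- by rewrite !path_mulDl IH IH'.
- by rewrite !path_mulZl IH.
elim/path_alg_ind: g => [|g g' IH IH'|c g IH|q].
- by rewrite path_mul0l path_mul0r path_mul0l.
- by rewrite path_mulDl !path_mulDr path_mulDl IH IH'.
- by rewrite path_mulZl !path_mulZr path_mulZl IH.
elim/path_alg_ind: h => [|h h' IH IH'|c h IH|r].
- by rewrite !path_mul0r.
- by rewrite !path_mulDr IH IH'.
- by rewrite !path_mulZr IH.
by rewrite !path_mul_basis path_mulA_basis.
Qed.

Fact path_mul1l : left_id path_one path_mul.
Proof.
move=> f; elim/path_alg_ind: f => [|f f' IH IH'|c f IH|p].
- by rewrite path_mul0r.
- by rewrite path_mulDr IH IH'.
- by rewrite path_mulZr IH.
rewrite path_mul_suml (bigD1 (qstart p)) //= big1 => [|v /negPf nv].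
  by rewrite addr0 path_mul_basis /pbasis_mul qconcat_trivl eqxx.
by rewrite path_mul_basis /pbasis_mul qconcat_trivl nv.
Qed.

Fact path_mul1r : right_id path_one path_mul.
Proof.
move=> f; elim/path_alg_ind: f => [|f f' IH IH'|c f IH|p].
- by rewrite path_mul0l.
- by rewrite path_mulDl IH IH'.
- by rewrite path_mulZl IH.
rewrite path_mul_sumr (bigD1 (qend p)) //= big1 => [|v /negPf nv].
  by rewrite addr0 path_mul_basis /pbasis_mul qconcat_trivr eqxx.
by rewrite path_mul_basis /pbasis_mul qconcat_trivr nv.
Qed.

Lemma path_one_coeff (v : qvert Q) : path_one@_(qtriv v) = 1.
Proof.
rewrite raddf_sum (bigD1 v) //= mcoeff_pbasis eqxx big1 ?addr0 //.
move=> w nw; rewrite mcoeff_pbasis; case: eqP => // -[wv].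
by rewrite wv eqxx in nw.
Qed.

Lemma path_mul_coeff f g (v : qvert Q) :
  (path_mul f g)@_(qtriv v) = f@_(qtriv v) * g@_(qtriv v).
Proof.
have key p q : (pbasis_mul p q)@_(qtriv v)
    = (p == qtriv v)%:R * (q == qtriv v)%:R :> k.
  rewrite /pbasis_mul; case: (qconcatP p q) => [r e rs ra _|ne].
    rewrite mcoeff_pbasis -natrM mulnb; congr (_%:R).
    have -> // : (r == qtriv v) = (p == qtriv v) && (q == qtriv v).
    apply/eqP/andP => [rv|[/eqP pv /eqP qv]]; last first.
      by apply: qpath_eq; rewrite ?rs ?ra pv ?qv.
    move: rs ra; rewrite rv /qarrows /= => pv.
    case E: (val p).2 => // /esym /= qa.
    have -> : p = qtriv v by apply: qpath_eq.
    split=> //; apply/eqP/qpath_eq => //.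
    by rewrite -e /qend /qarrows E /= -pv.
  rewrite mcoeff0 -natrM mulnb.
  case: andP => // -[/eqP pv /eqP qv].
  by move: ne; rewrite pv qv eqxx.
have coeffE (h : path_alg) :
    h@_(qtriv v) = \sum_(p <- msupp h) h@_p * (p == qtriv v)%:R.
  rewrite {1}[h]pbasisE raddf_sum; apply: eq_bigr => p _.
  by rewrite /= mcoeffZ mcoeff_pbasis.
rewrite path_mulE raddf_sum [f@_(qtriv v)]coeffE [g@_(qtriv v)]coeffE mulr_suml.
apply: eq_bigr => p _; rewrite raddf_sum mulr_sumr; apply: eq_bigr => q _.
by rewrite /= mcoeffZ key mulrACA.
Qed.

Fact path_one_neq0 : path_one != 0.
Proof.
have /card_gt0P[v _] := qvert_gt0 Q.
apply/eqP => /malgP/(_ (qtriv v)); rewrite path_one_coeff mcoeff0 => /eqP.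
by rewrite oner_eq0.
Qed.

HB.instance Definition _ := GRing.Zmodule_isNzRing.Build path_alg
  path_mulA path_mul1l path_mul1r path_mulDl path_mulDr path_one_neq0.
HB.instance Definition _ := GRing.Lmodule_isLalgebra.Build k path_alg
  (fun c f g => esym (path_mulZl c f g)).
HB.instance Definition _ := GRing.Lalgebra_isAlgebra.Build k path_alg
  (fun c f g => esym (path_mulZr c f g)).

Lemma pbasisM p q : pbasis p * pbasis q = pbasis_mul p q.
Proof. exact: path_mul_basis. Qed.

Lemma mcoeff_triv1 (v : qvert Q) : (1 : path_alg)@_(qtriv v) = 1.
Proof. exact: path_one_coeff. Qed.

Lemma mcoeff_trivM f g (v : qvert Q) :
  (f * g)@_(qtriv v) = f@_(qtriv v) * g@_(qtriv v).
Proof. exact: path_mul_coeff. Qed.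

End PathAlgebra.

Section QuotientAlgebra.
Local Open Scope quotient_scope.
Variables (k : fieldType) (A : algType k) (w : A).

Definition ideal_gen : {pred A} :=
  [pred x | `[< exists s : seq (A * A), x = \sum_(u <- s) u.1 * w * u.2 >]].

Lemma ideal_genP x :
  reflect (exists s : seq (A * A), x = \sum_(u <- s) u.1 * w * u.2)
          (x \in ideal_gen).
Proof. exact: asboolP. Qed.

Lemma ideal_genMl a x : x \in ideal_gen -> a * x \in ideal_gen.
Proof.
move=> /ideal_genP[s ->]; apply/ideal_genP.
exists [seq (a * u.1, u.2) | u <- s]; rewrite big_map mulr_sumr.
by apply: eq_bigr => u _; rewrite !mulrA.
Qed.

Lemma ideal_genMr a x : x \in ideal_gen -> x * a \in ideal_gen.
Proof.
move=> /ideal_genP[s ->]; apply/ideal_genP.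
exists [seq (u.1, u.2 * a) | u <- s]; rewrite big_map mulr_suml.
by apply: eq_bigr => u _; rewrite !mulrA.
Qed.

Lemma ideal_gen_id : w \in ideal_gen.
Proof.
by apply/ideal_genP; exists [:: (1, 1)]; rewrite big_seq1 mul1r mulr1.
Qed.

Fact ideal_gen_zmod_closed : zmod_closed ideal_gen.
Proof.
split=> [|x y /ideal_genP[s ->] /(ideal_genMl (-1)) /ideal_genP[t]].
  by apply/ideal_genP; exists [::]; rewrite big_nil.
rewrite mulN1r => ->.
by apply/ideal_genP; exists (s ++ t); rewrite big_cat.
Qed.
HB.instance Definition _ :=
  GRing.isZmodClosed.Build A ideal_gen ideal_gen_zmod_closed.

Definition quot_alg : Type := Quotient.quot ideal_gen.
HB.instance Definition _ := GRing.Zmodule.on quot_alg.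

Definition quot_pi : A -> quot_alg := \pi_(Quotient.quot ideal_gen).

Implicit Types x y z : quot_alg.

Lemma quot_pi_surj x : exists a, quot_pi a = x.
Proof. by exists (repr x); rewrite /quot_pi reprK. Qed.

Lemma quot_piP a b : reflect (quot_pi a = quot_pi b) (a - b \in ideal_gen).
Proof. by rewrite Quotient.idealrBE; apply: eqP. Qed.

Fact quot_pi_zmod_morphism : zmod_morphism quot_pi.
Proof. by move=> a b; rewrite /quot_pi !piE. Qed.
HB.instance Definition _ :=
  GRing.isZmodMorphism.Build A quot_alg quot_pi quot_pi_zmod_morphism.

Lemma quot_piD a b : quot_pi (a + b) = quot_pi a + quot_pi b.
Proof. exact: raddfD. Qed.

Definition quot_one : quot_alg := quot_pi 1.
Definition quot_mul x y : quot_alg := quot_pi (repr x * repr y).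
Definition quot_scale (c : k) x : quot_alg := quot_pi (c *: repr x).

Lemma quot_repr a : repr (quot_pi a) - a \in ideal_gen.
Proof. by apply/quot_piP; rewrite /quot_pi reprK. Qed.

Lemma quot_piM a b : quot_mul (quot_pi a) (quot_pi b) = quot_pi (a * b).
Proof.
apply/quot_piP; set a' := repr (quot_pi a); set b' := repr (quot_pi b).
have -> : a' * b' - a * b = (a' - a) * b' + a * (b' - b).
  by rewrite mulrBl mulrBr addrA subrK.
rewrite rpredD //; first exact/ideal_genMr/quot_repr.
exact/ideal_genMl/quot_repr.
Qed.

Lemma quot_piZ c a : quot_scale c (quot_pi a) = quot_pi (c *: a).
Proof.
apply/quot_piP; rewrite -scalerBr -[_ - a]mul1r scalerAl.
exact/ideal_genMl/quot_repr.
Qed.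

Fact quot_mulA : associative quot_mul.
Proof.
move=> x y z; case: (quot_pi_surj x) (quot_pi_surj y) (quot_pi_surj z).
by move=> a <- [b <-] [c <-]; rewrite !quot_piM mulrA.
Qed.
Fact quot_mul1l : left_id quot_one quot_mul.
Proof. by move=> x; case: (quot_pi_surj x) => a <-; rewrite quot_piM mul1r. Qed.
Fact quot_mul1r : right_id quot_one quot_mul.
Proof. by move=> x; case: (quot_pi_surj x) => a <-; rewrite quot_piM mulr1. Qed.
Fact quot_mulDl : left_distributive quot_mul +%R.
Proof.
move=> x y z; case: (quot_pi_surj x) (quot_pi_surj y) (quot_pi_surj z).
by move=> a <- [b <-] [c <-]; rewrite -(quot_piD a) !quot_piM mulrDl quot_piD.
Qed.
Fact quot_mulDr : right_distributive quot_mul +%R.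
Proof.
move=> x y z; case: (quot_pi_surj x) (quot_pi_surj y) (quot_pi_surj z).
by move=> a <- [b <-] [c <-]; rewrite -(quot_piD b) !quot_piM mulrDr quot_piD.
Qed.

HB.instance Definition _ := GRing.Zmodule_isPzRing.Build quot_alg
  quot_mulA quot_mul1l quot_mul1r quot_mulDl quot_mulDr.

Fact quot_scaleA a b x : quot_scale a (quot_scale b x) = quot_scale (a * b) x.
Proof. by case: (quot_pi_surj x) => c <-; rewrite !quot_piZ scalerA. Qed.
Fact quot_scale1 : left_id 1 quot_scale.
Proof.
by move=> x; case: (quot_pi_surj x) => c <-; rewrite quot_piZ scale1r.
Qed.
Fact quot_scaleDr : right_distributive quot_scale +%R.
Proof.
move=> a x y; case: (quot_pi_surj x) (quot_pi_surj y) => b <- [c <-].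
by rewrite -(quot_piD b) !quot_piZ scalerDr quot_piD.
Qed.
Fact quot_scaleDl x : {morph quot_scale^~ x : a b / a + b}.
Proof.
move=> a b; case: (quot_pi_surj x) => c <-.
by rewrite !quot_piZ scalerDl quot_piD.
Qed.

HB.instance Definition _ := GRing.Zmodule_isLmodule.Build k quot_alg
  quot_scaleA quot_scale1 quot_scaleDr quot_scaleDl.

Fact quot_pi_scalable : scalable quot_pi.
Proof. by move=> c a; rewrite -quot_piZ. Qed.
Fact quot_pi_monoid_morphism : monoid_morphism quot_pi.
Proof. by split=> // a b; rewrite -quot_piM. Qed.
HB.instance Definition _ :=
  GRing.isScalable.Build k A quot_alg *:%R quot_pi quot_pi_scalable.
HB.instance Definition _ :=
  GRing.isMonoidMorphism.Build A quot_alg quot_pi quot_pi_monoid_morphism.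

Fact quot_scalerAl c x y : c *: (x * y) = (c *: x) * y.
Proof.
case: (quot_pi_surj x) (quot_pi_surj y) => a <- [b <-].
have M u v : quot_pi u * quot_pi v = quot_pi (u * v) by apply: quot_piM.
have Z u : c *: quot_pi u = quot_pi (c *: u) by apply: quot_piZ.
by rewrite M !Z M scalerAl.
Qed.

Fact quot_scalerAr c x y : c *: (x * y) = x * (c *: y).
Proof.
case: (quot_pi_surj x) (quot_pi_surj y) => a <- [b <-].
have M u v : quot_pi u * quot_pi v = quot_pi (u * v) by apply: quot_piM.
have Z u : c *: quot_pi u = quot_pi (c *: u) by apply: quot_piZ.
by rewrite M !Z M scalerAr.
Qed.

End QuotientAlgebra.

Section Preprojective.
Variables (k : fieldType) (n : nat) (n_ge3 : (3 <= n)%N).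

Fact cyc_double_subproof : (0 < #|'I_n|)%N.
Proof. by rewrite card_ord; apply: leq_trans n_ge3. Qed.

(* inl i is the arrow alpha_i from i to i + 1 (mod n), and inr i the arrow
   alpha_i^* from i + 1 to i. *)
Definition cyc_double : quiver := {|
  qvert := 'I_n;
  qarr := ('I_n + 'I_n)%type;
  qsrc := fun a => match a with inl i => i | inr i => ordS i end;
  qtgt := fun a => match a with inl i => ordS i | inr i => i end;
  qvert_gt0 := cyc_double_subproof |}.

Definition path_alpha (i : 'I_n) : path_alg k cyc_double :=
  parrow k (inl i : qarr cyc_double).
Definition path_alpha_star (i : 'I_n) : path_alg k cyc_double :=
  parrow k (inr i : qarr cyc_double).

Definition Omega : path_alg k cyc_double :=
  \sum_(i < n)
    (path_alpha i * path_alpha_star i - path_alpha_star i * path_alpha i).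

Definition preproj : Type := quot_alg Omega.
HB.instance Definition _ := GRing.Lmodule.on preproj.
HB.instance Definition _ := GRing.PzRing.on preproj.

Fact preproj_one_neq0 : (1 : preproj) != 0.
Proof.
have /card_gt0P[v _] := cyc_double_subproof.
apply/eqP => e; have /quot_piP : quot_pi Omega 1 = quot_pi Omega 0.
  by rewrite [RHS]raddf0; exact: e.
rewrite subr0 => /ideal_genP[s].
move/malgP/(_ (qtriv (v : qvert cyc_double))).
rewrite (mcoeff_triv1 k (v : qvert cyc_double)) raddf_sum big1 => [/eqP|u _].
  by rewrite oner_eq0.
rewrite /= !mcoeff_trivM; suff -> : Omega@_(qtriv (v : qvert cyc_double)) = 0.
  by rewrite mulr0 mul0r.
rewrite raddf_sum big1 // => i _.
by rewrite raddfB /= !mcoeff_trivM mulrC subrr.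
Qed.

HB.instance Definition _ :=
  GRing.PzSemiRing_isNonZero.Build preproj preproj_one_neq0.
HB.instance Definition _ := GRing.Lmodule_isLalgebra.Build k preproj
  (@quot_scalerAl _ _ Omega).
HB.instance Definition _ := GRing.Lalgebra_isAlgebra.Build k preproj
  (@quot_scalerAr _ _ Omega).

Definition preproj_pi : path_alg k cyc_double -> preproj := quot_pi Omega.
HB.instance Definition _ := GRing.LRMorphism.on preproj_pi.

Definition vtx (i : 'I_n) : preproj :=
  preproj_pi (ptriv k (i : qvert cyc_double)).
Definition alpha (i : 'I_n) : preproj := preproj_pi (path_alpha i).
Definition alpha_star (i : 'I_n) : preproj := preproj_pi (path_alpha_star i).

(* The span of the images of the paths of length d. *)
Definition graded_piece (d : nat) (x : preproj) : Prop :=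
  exists2 f : path_alg k cyc_double,
    forall p, p \in msupp f -> qlength p = d & x = preproj_pi f.

Definition graded_aut (s : algAut preproj) : Prop :=
  forall d x, graded_piece d x -> graded_piece d (s x).

Definition finite_graded_aut (s : algAut preproj) : Prop :=
  [/\ graded_aut s, finite_order s & forall i, s (vtx i) = vtx i].

Lemma finite_graded_aut_order s : finite_graded_aut s -> finite_order s.
Proof. by case. Qed.

End Preprojective.

(* Main.v *)
Require Import Defs.
From HB Require Import structures.
From mathcomp Require Import all_boot all_order all_algebra.
From mathcomp Require Import finmap.
From mathcomp Require Import boolp.
From mathcomp.multinomials Require Import monalg.

Set Implicit Arguments.
Unset Strict Implicit.
Unset Printing Implicit Defensive.

Import GRing.Theory.

Local Open Scope ring_scope.

(** Write X for the sum of the arrows alpha_i and Y for the sum of the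
    alpha_i^*.  Then Omega = XY - YX, so every path in R equals e_i X^a Y^b for
    its starting vertex i, and R is a free right k[X,Y]-module on the
    idempotents e_i.  From this come the three properties of R that matter: X
    and Y are not right zero divisors, XY is central, and X^a and Y^b are
    coprime in the sense that r Y^b = r' X^a forces r to be a left multiple of
    X^a ([sum_alpha_coprime]).

    As e_(i+1) XY is both alpha_(i+1) alpha_(i+1)^* and alpha_i^* alpha_i, the
    product xi_i xi_i^* does not depend on i, hence is 1.  So XY is fixed, and
    both e_i X^a and the reverse walk e_(i+a) Y^a are eigenvectors of sigma,
    with inverse eigenvalues: the product of the xi along the walk of length a
    from i, and its inverse.  In each of the three cases these products run,
    for every starting vertex i, through all powers of a primitive m-th root of
    unity zeta.  For the third case, the product of numbers of pairwise coprime
    orders has order m, which makes it an instance of the second.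

    These eigenvectors are all that the isomorphism needs.

    Injectivity ([auslander_inj]): if the sum of the u_t sigma^t vanishes on R,
    evaluating it on an eigenvector e_i X^a of eigenvalue zeta^j and cancelling
    X^a shows that the sum of the zeta^(jt) u_t e_i is 0 for every j, and
    Fourier inversion over the m-th roots of unity gives u_t e_i = 0.

    Surjectivity: by Fourier inversion again ([auslander_surj]), an
    endomorphism p is in the image as soon as on each eigenspace of sigma in
    e_i R it is left multiplication by some h.  Take u = e_i X^a and
    w = e_i Y^b with the same eigenvalue c.  For every v in e_i R of
    eigenvalue c, u (Y^a v) = v (XY)^a, where Y^a v and (XY)^a are fixed, so
    p(u) Y^a v = p(v) (XY)^a: the ratio of p(v) to v is always that of p(u) to
    u.  For v = w this reads p(u) Y^b = p(w) X^a, and coprimality makes the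
    common ratio an element h of R ([fixed_endo_left_mul]). *)

(** * Sums over a finite cyclic group *)

Lemma group_order_gt0 (gT : groupType) (x : gT) :
  finite_order x -> (0 < group_order x)%N.
Proof. by case/least_posP. Qed.

Lemma expg_group_order (gT : groupType) (x : gT) :
  finite_order x -> (x ^+ group_order x = 1)%g.
Proof. by case/least_posP => _ /eqP. Qed.

Lemma group_order_le (gT : groupType) (x : gT) d :
  finite_order x -> (0 < d)%N -> (x ^+ d = 1)%g -> (group_order x <= d)%N.
Proof. by case/least_posP => _ _ + d0 xd => -> //; rewrite xd. Qed.

Lemma inj_surj_bij (T U : Type) (f : T -> U) :
  injective f -> (forall y, exists x, f x = y) -> bijective f.
Proof.
move=> f_inj f_surj; pose g y := projT1 (cid (f_surj y)).
have gK : cancel g f by move=> y; apply: projT2 (cid (f_surj y)).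
by exists g => // x; apply: f_inj.
Qed.

Section CycleSum.
Variables (gT : groupType) (x : gT) (fin_x : finite_order x).

Definition cycle_elt t : cycle_group fin_x := [` cycle_fsetX fin_x t]%fset.

Lemma cycle_elt_bij : bijective (fun t : 'I_(group_order x) => cycle_elt t).
Proof.
have inj (t u : 'I_(group_order x)) : (t <= u)%N ->
    cycle_elt t = cycle_elt u -> t = u.
  move=> le_tu /(congr1 val) /= e; apply: val_inj => /=; apply/eqP.
  rewrite eqn_leq le_tu leqNgt; apply/negP => lt_tu.
  have := group_order_le (d := u - t) fin_x; rewrite subn_gt0 lt_tu => /(_ isT).
  have -> : (x ^+ (u - t) = 1)%g.
    by apply: (mulgI (x ^+ t)%g); rewrite -expgnDr subnKC // mulg1.
  move=> /(_ erefl); rewrite leqNgt => /negP; apply.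
  exact: leq_ltn_trans (leq_subr _ _) (ltn_ord u).
apply: inj_surj_bij => [t u e|y].
  by case/orP: (leq_total t u) => /inj; [|move/(_ (esym e))]; auto.
by have /imfsetP[t _ yt] := valP y; exists t; apply: val_inj.
Qed.

Lemma cycle_sum (V : nmodType) (F : cycle_group fin_x -> V) :
  \sum_g F g = \sum_(t < group_order x) F (cycle_elt t).
Proof. by rewrite (reindex _ (onW_bij _ cycle_elt_bij)). Qed.

End CycleSum.

(** * Bijectivity of the Auslander map from eigenvectors *)

Lemma sum_unity_root (k : fieldType) m (z : k) : z ^+ m = 1 ->
  \sum_(t < m) z ^+ t = if z == 1 then m%:R else 0.
Proof.
move=> zm; have [->|z1] := eqVneq z 1.
  by under eq_bigr do rewrite expr1n; rewrite sumr_const card_ord.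
have /eqP := subrX1 z m; rewrite zm subrr eq_sym mulf_eq0 subr_eq0 (negPf z1).
by move/eqP.
Qed.

Section Criterion.
Variables (k : fieldType) (A : algType k) (s : algAut A).
Variables (s_fin : finite_order s) (zeta : k).
Local Notation m := (group_order s).
Local Notation G := (cycle_group s_fin).
Hypothesis (zeta_prim : m.-primitive_root zeta) (m_neq0 : m%:R != 0 :> k).
Implicit Types (v : A).

Lemma zeta_neq0 : zeta != 0.
Proof.
apply/eqP => z0; have := prim_expr_order zeta_prim.
rewrite z0 expr0n (gtn_eqF (prim_order_gt0 zeta_prim)) => /eqP.
by rewrite eq_sym oner_eq0.
Qed.

Lemma zeta_orthogonal (i j : 'I_m) :
  \sum_(t < m) zeta ^+ (i * t) * zeta ^- (j * t) = if i == j then m%:R else 0.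
Proof.
under eq_bigr => t _ do rewrite !exprM -exprVn -exprMn.
rewrite sum_unity_root; last first.
  rewrite expr_div_n -!exprM ![(_ * m)%N]mulnC !exprM.
  by rewrite (prim_expr_order zeta_prim) !expr1n divr1.
have zj : zeta ^+ j != 0 by rewrite expf_neq0 // zeta_neq0.
rewrite -[_ == 1](inj_eq (mulIf zj)) mul1r divfK //.
by rewrite (eq_prim_root_expr zeta_prim) !modn_small.
Qed.

Lemma aut_expgS (t : nat) v : (s ^+ t.+1)%g v = s ((s ^+ t)%g v).
Proof. by rewrite expgS. Qed.

Lemma eigen_expg (c : k) t v : s v = c *: v -> (s ^+ t)%g v = c ^+ t *: v.
Proof.
move=> sv; elim: t => [|t IH]; first by rewrite scale1r.
by rewrite aut_expgS IH linearZ /= sv scalerA exprSr.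
Qed.

Lemma aut_expg_fix t v : s v = v -> (s ^+ t)%g v = v.
Proof. by move=> sv; elim: t => // t IH; rewrite aut_expgS IH. Qed.

Lemma auslander_cycle (u : skew_ring G) v :
  auslander G u v = \sum_(t < m) u (cycle_elt s_fin t) * (s ^+ t)%g v.
Proof. by rewrite /= /auslander_fun cycle_sum. Qed.

Variables (I : finType) (e : I -> A).
Hypotheses (sum_e : \sum_i e i = 1) (e_idem : forall i, e i * e i = e i).
Hypothesis s_e : forall i, s (e i) = e i.

(** The values zeta^(jt) for j < m form an invertible matrix, so one
    eigenvector for each power of zeta separates the m coefficients of an
    element of the skew group ring; right cancellation of w removes the
    eigenvector. *)
Lemma auslander_inj :
  (forall (i : I) (j : nat), exists2 w, s (e i * w) = zeta ^+ j *: (e i * w)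
     & forall r, r * w = 0 -> r = 0) ->
  injective (auslander G).
Proof.
move=> eigen; apply: raddf_inj => u /(congr1 (@endo_fun _ _ _)) u0.
have {}u0 v : \sum_(t < m) u (cycle_elt s_fin t) * (s ^+ t)%g v = 0.
  by rewrite -auslander_cycle u0.
suff uE (t : 'I_m) : u (cycle_elt s_fin t) = 0.
  apply/ffunP => g; rewrite ffunE.
  by have [h _ hK] := cycle_elt_bij s_fin; rewrite -[g]hK.
rewrite -[LHS]mulr1 -sum_e mulr_sumr big1 // => i _.
have uE j : \sum_(l < m) zeta ^+ (l * j) *: (u (cycle_elt s_fin l) * e i) = 0.
  have [w sw] := eigen i j; apply; rewrite mulr_suml -[RHS](u0 (e i * w)).
  apply: eq_bigr => l _.
  by rewrite (eigen_expg _ sw) -exprM mulnC -scalerAl -mulrA scalerAr.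
have : \sum_(j < m) zeta ^- (t * j) *:
    (\sum_(l < m) zeta ^+ (l * j) *: (u (cycle_elt s_fin l) * e i)) = 0.
  by rewrite big1 // => j _; rewrite uE scaler0.
under eq_bigr => j _ do rewrite scaler_sumr.
rewrite exchange_big /= (bigD1 t) //= [X in _ + X]big1 => [|l lt]; last first.
  under eq_bigr => j _ do rewrite scalerA mulrC.
  by rewrite -scaler_suml zeta_orthogonal (negPf lt) scale0r.
under eq_bigr => j _ do rewrite scalerA mulrC.
rewrite -scaler_suml zeta_orthogonal eqxx addr0.
move=> /(congr1 (GRing.scale m%:R^-1)).
by rewrite scalerA mulVf // scale1r scaler0.
Qed.

(** The projection onto the zeta^j-eigenspace of s: the Fourier transform of
    the action of the cyclic group. *)
Definition eigen_proj (j : nat) v : A :=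
  m%:R^-1 *: \sum_(t < m) zeta ^- (j * t) *: (s ^+ t)%g v.

Lemma eigen_projP j v : s (eigen_proj j v) = zeta ^+ j *: eigen_proj j v.
Proof.
pose F t := zeta ^- (j * t) *: (s ^+ t)%g v.
have shift : \sum_(t < m) F t.+1 = \sum_(t < m) F t.
  have Fm : F m = F 0.
    rewrite /F expg_group_order // muln0 mulnC exprM.
    by rewrite (prim_expr_order zeta_prim) expr1n.
  case: m Fm => [|d] Fm; first by rewrite !big_ord0.
  by rewrite big_ord_recr [RHS]big_ord_recl /= Fm addrC.
rewrite /eigen_proj linearZ /= scalerA mulrC -scalerA; congr (_ *: _).
rewrite raddf_sum -[in RHS]shift scaler_sumr; apply: eq_bigr => t _.
rewrite /= linearZ /= /F scalerA mulnS exprD invfM mulrA divff.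
  by rewrite mul1r aut_expgS.
by rewrite expf_neq0 // zeta_neq0.
Qed.

Lemma sum_eigen_proj v : \sum_(j < m) eigen_proj j v = v.
Proof.
rewrite -scaler_sumr exchange_big /=.
have m_gt0 := prim_order_gt0 zeta_prim; pose t0 := Ordinal m_gt0.
rewrite (bigD1 t0) //= [X in _ + X]big1 => [|t nt].
  under eq_bigr => j _ do rewrite /= muln0 expr0 invr1 scale1r.
  by rewrite sumr_const card_ord addr0 -scaler_nat scalerA mulVf ?scale1r.
rewrite -scaler_suml; have := zeta_orthogonal t0 t; rewrite eq_sym (negPf nt).
under eq_bigr do rewrite mul0n mul1r mulnC; move=> ->.
by rewrite scale0r.
Qed.

(** The eigenspace projections are themselves k-combinations of the powers of
    s, so an endomorphism which multiplies each eigenspace of e_i A by an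
    element h_ij is the sum of the h_ij e_i followed by these projections, and
    this has the form of an Auslander image. *)
Lemma auslander_surj :
  (forall (p : fixed_endo G) (i : I) (j : nat), exists h, forall v,
     e i * v = v -> s v = zeta ^+ j *: v -> p v = h * v) ->
  forall p, exists u, auslander G u = p.
Proof.
move=> loc p.
have [h hP] : exists h : I -> nat -> A, forall i j v,
    e i * v = v -> s v = zeta ^+ j *: v -> p v = h i j * v.
  exists (fun i j => projT1 (cid (loc p i j))) => i j.
  exact: projT2 (cid (loc p i j)).
have [rank cycK _] := cycle_elt_bij s_fin.
pose u : skew_ring G := [ffun g => m%:R^-1 *: \sum_i \sum_(j < m)
  zeta ^- (j * rank g) *: (h i j * e i)].
exists u; apply: fixed_endo_eq => v; rewrite auslander_cycle.
have proj_e i j : e i * eigen_proj j (e i * v) = eigen_proj j (e i * v).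
  rewrite /eigen_proj -scalerAr mulr_sumr; congr (_ *: _).
  apply: eq_bigr => t _; rewrite -scalerAr; congr (_ *: _).
  by rewrite -{1}[e i](aut_expg_fix t (s_e i)) -rmorphM mulrA e_idem.
transitivity (\sum_i \sum_(j < m) h i j * eigen_proj j (e i * v)); last first.
  rewrite -[in RHS](mul1r v) -sum_e mulr_suml raddf_sum.
  apply: eq_bigr => i _ /=.
  rewrite -[in RHS](sum_eigen_proj (e i * v)) raddf_sum.
  apply: eq_bigr => j _ /=.
  by rewrite (hP i j) ?eigen_projP.
under eq_bigr => t _ do rewrite ffunE cycK -scalerAl mulr_suml.
rewrite -scaler_sumr exchange_big scaler_sumr; apply: eq_bigr => i _ /=.
under eq_bigr => t _ do rewrite mulr_suml.
rewrite exchange_big scaler_sumr; apply: eq_bigr => j _ /=.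
rewrite /eigen_proj -scalerAr mulr_sumr; congr (_ *: _).
apply: eq_bigr => t _; rewrite -scalerAl -scalerAr rmorphM mulrA.
by rewrite /= (aut_expg_fix t (s_e i)).
Qed.

Lemma mem_fixed_cycle v : s v = v -> v \in fixed_ring G.
Proof.
move=> sv; apply/fixed_ringP => g /(cycle_fsetP s_fin)[t ->].
exact: aut_expg_fix.
Qed.

Lemma regular_exp (x : A) a :
  (forall r, r * x = 0 -> r = 0) -> forall r, r * x ^+ a = 0 -> r = 0.
Proof.
move=> x_reg; elim: a => [|a IH] r; first by rewrite mulr1.
by rewrite exprSr mulrA => /x_reg/IH.
Qed.

(** Two commuting elements that are not central, but whose product is: they
    move from one idempotent e_i to another, and their product does not. *)
Variables x y : A.
Hypothesis xyC : x * y = y * x.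
Hypothesis xy_central : forall r, x * y * r = r * (x * y).
Hypothesis s_xy : s (x * y) = x * y.
Hypotheses (x_reg : forall r, r * x = 0 -> r = 0).
Hypotheses (y_reg : forall r, r * y = 0 -> r = 0).
Hypothesis xy_coprime : forall r r' a b,
  r * y ^+ b = r' * x ^+ a -> exists h, r = h * x ^+ a.

(** Since e_i x^a (y^a v) = v (xy)^a with y^a v and (xy)^a fixed by s, the
    value of p at e_i x^a determines p(v), and p(v) has the same formal
    quotient by v for every v of the eigenspace.  Comparing the eigenvectors
    e_i x^a and e_i y^b shows that this quotient has no denominator. *)
Lemma fixed_endo_left_mul (p : fixed_endo G) (c : k) i i' a b : c != 0 ->
  e i * x ^+ a = x ^+ a * e i' -> e i' * y ^+ a = y ^+ a * e i ->
  s (e i * x ^+ a) = c *: (e i * x ^+ a) ->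
  s (e i' * y ^+ a) = c^-1 *: (e i' * y ^+ a) ->
  s (e i * y ^+ b) = c *: (e i * y ^+ b) ->
  exists h, forall v, e i * v = v -> s v = c *: v -> p v = h * v.
Proof.
move=> c0 exE eyE sx sy sw.
have xyE : x ^+ a * y ^+ a = (x * y) ^+ a by rewrite exprMn_comm.
have xy_comm v : x ^+ a * y ^+ a * v = v * (x ^+ a * y ^+ a).
  by rewrite xyE; apply/esym/commrX/esym/xy_central.
have s_xya : s (x ^+ a * y ^+ a) = x ^+ a * y ^+ a.
  by rewrite xyE rmorphXn /= s_xy.
have key v : e i * v = v -> s v = c *: v ->
    p (e i * x ^+ a) * (y ^+ a * v) = p v * (x ^+ a * y ^+ a).
  move=> ev sv.
  have wE : e i' * y ^+ a * v = y ^+ a * v by rewrite eyE -mulrA ev.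
  rewrite -!fixed_endoM; first last.
  (* s scales e_i' y^a by c^-1 and v by c, so their product is fixed *)
  - apply: mem_fixed_cycle; rewrite -wE rmorphM /= sy sv.
    by rewrite -scalerAl -scalerAr scalerA mulVf // scale1r.
  - exact: mem_fixed_cycle.
  by rewrite -mulrA [x ^+ a * (_ * _)]mulrA xy_comm mulrA ev.
have pxE : p (e i * x ^+ a) * e i' = p (e i * x ^+ a).
  rewrite -fixed_endoM; last exact: mem_fixed_cycle.
  by rewrite exE -mulrA e_idem.
have [h hE] : exists h, p (e i * x ^+ a) = h * x ^+ a.
  apply: (@xy_coprime _ (p (e i * y ^+ b)) a b).
  apply: (subr0_eq (regular_exp (a := a) y_reg _)).
  (* the key identity at v = e_i y^b, before cancelling y^a *)
  apply/eqP; rewrite mulrBl subr_eq0 -[_ * _ * y ^+ a]mulrA -[X in _ == X]mulrA.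
  rewrite -(key (e i * y ^+ b)) ?mulrA ?e_idem // -[_ * y ^+ a * e i]mulrA -eyE.
  by rewrite mulrA pxE -!mulrA -!exprD addnC.
exists h => v ev sv.
have {}key := key v ev sv.
(* both sides agree after multiplication by (xy)^a *)
apply: (subr0_eq (regular_exp (a := a) x_reg (regular_exp (a := a) y_reg _))).
apply/eqP; rewrite !mulrBl subr_eq0 -!mulrA -key hE.
by rewrite -xy_comm !mulrA.
Qed.

(** Every power of zeta has to occur twice: along x, with a way back along y
    of inverse eigenvalue, which brings the values of p at the whole eigenspace
    to a common denominator x^a; and along y, to clear this denominator. *)
Lemma auslander_bij :
  (forall i (j : nat),
    (exists a i', [/\ e i * x ^+ a = x ^+ a * e i',
       e i' * y ^+ a = y ^+ a * e i,
       s (e i * x ^+ a) = zeta ^+ j *: (e i * x ^+ a)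
     & s (e i' * y ^+ a) = (zeta ^+ j)^-1 *: (e i' * y ^+ a)])
    /\ exists b, s (e i * y ^+ b) = zeta ^+ j *: (e i * y ^+ b)) ->
  bijective (auslander G).
Proof.
move=> eigen; apply: inj_surj_bij.
  apply: auslander_inj => i j; have [[a [i' [_ _ sx _]]] _] := eigen i j.
  by exists (x ^+ a) => //; apply: regular_exp.
apply: auslander_surj => p i j.
have [[a [i' [exE eyE sx sy]]] [b sw]] := eigen i j.
by apply: fixed_endo_left_mul exE eyE sx sy sw; rewrite expf_neq0 ?zeta_neq0.
Qed.

End Criterion.

(** * The preprojective algebra as a free module over k[x,y] *)

Lemma sum_at (V : nmodType) n (F : 'I_n -> V) l :
  \sum_i (if i == l then F i else 0) = F l.
Proof. by rewrite -big_mkcond big_pred1_eq. Qed.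

Lemma sum_at_ordS (V : nmodType) n (F : 'I_n -> V) l :
  \sum_i (if ordS i == l then F (ordS i) else 0) = F l.
Proof. by rewrite -[RHS]sum_at [RHS](reindex_inj (@ordS_inj n)). Qed.

Section NormalForm.
Variables (k : fieldType) (n : nat) (n_ge3 : (3 <= n)%N).
Local Notation Q := (cyc_double n_ge3).
Local Notation PA := (path_alg k Q).
Local Notation R := (preproj k n_ge3).
Local Notation pi := (@preproj_pi k n n_ge3).
Local Notation S := {poly {poly k}}.
Implicit Types (p q : qpath Q) (f g : PA) (i j : 'I_n).

(** S is k[y][x]: the outer variable 'X stands for x and the constant 'X%:P
    for y. *)
Definition arrow_wt (a : qarr Q) : S :=
  match a with inl _ => 'X | inr _ => 'X%:P end.

Definition path_wt p : S := \prod_(a <- qarrows p) arrow_wt a.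

(** The coordinate at the basis vector e_l of R over k[x,y], as a function on
    the path algebra.  Forgetting the end of a path loses nothing: it is
    determined by the start and the weight. *)
Definition coord (l : 'I_n) : PA -> S :=
  mmap (polyC \o polyC) (fun p => if qstart p == l then path_wt p else 0).

Fact coord_additive l : zmod_morphism (coord l).
Proof. exact: mmap_is_additive. Qed.
HB.instance Definition _ l :=
  GRing.isZmodMorphism.Build PA S (coord l) (coord_additive l).

Lemma coordZ l c f : coord l (c *: f) = c%:P%:P * coord l f.
Proof.
rewrite /coord (mmapEw (msuppZ_le c f)) mmapE mulr_sumr.
by apply: eq_bigr => p _; rewrite mcoeffZ /= !rmorphM mulrA.
Qed.

Lemma coord_basis l p :
  coord l (pbasis k p) = if qstart p == l then path_wt p else 0.
Proof. by rewrite pbasis.unlock /coord mmapU /= mul1r. Qed.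

(** Left multiplication by a path acts on coordinates, which is what makes
    them compatible with two-sided ideals. *)
Lemma coord_basisM l p g :
  coord l (pbasis k p * g) =
    if qstart p == l then path_wt p * coord (qend p) g else 0.
Proof.
elim/path_alg_ind: g => [|f g IHf IHg|c f IHf|q].
- by rewrite mulr0 !raddf0 mulr0 if_same.
- by rewrite mulrDr !raddfD /= IHf IHg; case: ifP; rewrite ?mulrDr ?addr0.
- by rewrite -scalerAr !coordZ IHf; case: ifP; rewrite ?mulr0 // mulrCA.
rewrite pbasisM /pbasis_mul coord_basis [qstart q == _]eq_sym.
case: (qconcatP p q) => [r e rs ra _|_]; last by rewrite raddf0 ?mulr0 if_same.
by rewrite coord_basis rs; case: ifP => // _; rewrite /path_wt ra big_cat.
Qed.

Definition path_sum_alpha : PA := \sum_i path_alpha k n_ge3 i.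
Definition path_sum_alpha_star : PA := \sum_i path_alpha_star k n_ge3 i.
Local Notation PX := path_sum_alpha.
Local Notation PY := path_sum_alpha_star.

Lemma coord_arrowM l (a : qarr Q) g :
  coord l (parrow k a * g) =
    if qsrc a == l then arrow_wt a * coord (qtgt a) g else 0.
Proof. by rewrite /parrow coord_basisM /path_wt big_seq1. Qed.

Lemma pathZl c f g : (c *: f) * g = c *: (f * g).
Proof. exact: path_mulZl. Qed.

(** Both alpha_i alpha_i^* and alpha_(i-1)^* alpha_(i-1) are loops of weight xy
    at i, and they enter Omega with opposite signs. *)
Lemma coord_Omega l g : coord l (Omega k n_ge3 * g) = 0.
Proof.
rewrite /Omega mulr_suml raddf_sum /=.
under eq_bigr => i _ do
  rewrite mulrBl raddfB /= -!mulrA /path_alpha /path_alpha_star !coord_arrowM /=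
    !eqxx mulrA ['X%:P * (_ * _)]mulrA ['X%:P * 'X]mulrC.
pose F i : S := 'X * 'X%:P * coord i g.
by rewrite sumrB (sum_at F) (sum_at_ordS F) subrr.
Qed.

Lemma coordM0 f g : (forall l, coord l g = 0) -> forall l, coord l (f * g) = 0.
Proof.
move=> g0 l; elim/path_alg_ind: f => [|f1 f2 IH1 IH2|c f IH|p].
- by rewrite mul0r raddf0.
- by rewrite mulrDl raddfD /= IH1 IH2 addr0.
- by rewrite (pathZl c f g) coordZ IH mulr0.
by rewrite coord_basisM g0 mulr0 if_same.
Qed.

Lemma coord_ideal l f : f \in ideal_gen (Omega k n_ge3) -> coord l f = 0.
Proof.
move=> /ideal_genP[s ->]; rewrite raddf_sum big1 // => -[u v] _ /=.
by rewrite -mulrA coordM0 // => j; apply: coord_Omega.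
Qed.

Lemma coord_pi l f g : pi f = pi g -> coord l f = coord l g.
Proof.
move/quot_piP => /(coord_ideal l) e; apply/eqP.
by rewrite -subr_eq0 -raddfB; apply/eqP.
Qed.

(** Elements with the same coordinate w at all vertices, such as X and Y, can be
    applied at the end of any path, whichever vertex that is. *)
Lemma coordMr (h : PA) (w : S) : (forall l, coord l h = w) ->
  forall l f, coord l (f * h) = coord l f * w.
Proof.
move=> hw l; elim/path_alg_ind => [|f1 f2 IH1 IH2|c f IH|p].
- by rewrite mul0r raddf0 mul0r.
- by rewrite mulrDl !raddfD /= IH1 IH2 mulrDl.
- transitivity (c%:P%:P * coord l (f * h)).
    by rewrite (pathZl c f h) coordZ.
  by rewrite IH coordZ mulrA.
by rewrite coord_basisM coord_basis hw; case: ifP; rewrite ?mul0r.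
Qed.

Lemma coord1 l : coord l 1 = 1.
Proof.
rewrite /GRing.one /= raddf_sum /=.
under eq_bigr => v _ do rewrite /ptriv coord_basis /path_wt big_nil /=.
exact: (sum_at (fun=> _)).
Qed.

Lemma coordX l : coord l PX = 'X.
Proof.
rewrite raddf_sum /=.
under eq_bigr => i _ do
  rewrite /path_alpha -[parrow _ _]mulr1 coord_arrowM coord1 mulr1.
exact: (sum_at (fun=> _)).
Qed.

Lemma coordY l : coord l PY = 'X%:P.
Proof.
rewrite raddf_sum /=.
under eq_bigr => i _ do
  rewrite /path_alpha_star -[parrow _ _]mulr1 coord_arrowM coord1 mulr1.
exact: (sum_at_ordS (fun=> 'X%:P)).
Qed.

Lemma ptriv_arrow i (a : qarr Q) :
  ptriv k (i : qvert Q) * parrow k a = if qsrc a == i then parrow k a else 0.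
Proof.
rewrite /ptriv /parrow pbasisM /pbasis_mul qconcat_trivl [i == _]eq_sym.
by case: ifP.
Qed.

Lemma arrow_ptriv i (a : qarr Q) :
  parrow k a * ptriv k (i : qvert Q) = if qtgt a == i then parrow k a else 0.
Proof.
rewrite /ptriv /parrow pbasisM /pbasis_mul qconcat_trivr [i == _]eq_sym.
by case: ifP.
Qed.

Lemma ptriv_PX i : ptriv k (i : qvert Q) * PX = path_alpha k n_ge3 i.
Proof.
rewrite mulr_sumr; under eq_bigr => j _ do rewrite ptriv_arrow /=.
exact: (sum_at (path_alpha k n_ge3)).
Qed.

Lemma PX_ptriv i : PX * ptriv k (ordS i : qvert Q) = path_alpha k n_ge3 i.
Proof.
rewrite mulr_suml; under eq_bigr => j _ do
  rewrite arrow_ptriv /= (inj_eq (@ordS_inj n)).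
exact: (sum_at (path_alpha k n_ge3)).
Qed.

Lemma ptriv_PY i :
  ptriv k (ordS i : qvert Q) * PY = path_alpha_star k n_ge3 i.
Proof.
rewrite mulr_sumr; under eq_bigr => j _ do
  rewrite ptriv_arrow /= (inj_eq (@ordS_inj n)).
exact: (sum_at (path_alpha_star k n_ge3)).
Qed.

Lemma PY_ptriv i : PY * ptriv k (i : qvert Q) = path_alpha_star k n_ge3 i.
Proof.
rewrite mulr_suml; under eq_bigr => j _ do rewrite arrow_ptriv /=.
exact: (sum_at (path_alpha_star k n_ge3)).
Qed.

(** Only the products of composable arrows survive in XY and YX, so the single
    relation Omega says that X and Y commute. *)
Lemma OmegaE : Omega k n_ge3 = PX * PY - PY * PX.
Proof.
rewrite /Omega sumrB; congr (_ - _).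
  rewrite [in RHS]/PX mulr_suml; apply: eq_bigr => i _.
  have {2}-> : path_alpha k n_ge3 i =
      path_alpha k n_ge3 i * ptriv k (ordS i : qvert Q).
    by rewrite arrow_ptriv eqxx.
  by rewrite -mulrA ptriv_PY.
rewrite [in RHS]/PY mulr_suml; apply: eq_bigr => i _.
have {2}-> : path_alpha_star k n_ge3 i =
    path_alpha_star k n_ge3 i * ptriv k (i : qvert Q).
  by rewrite arrow_ptriv eqxx.
by rewrite -mulrA ptriv_PX.
Qed.

Definition sum_alpha : R := pi PX.
Definition sum_alpha_star : R := pi PY.
Local Notation X := sum_alpha.
Local Notation Y := sum_alpha_star.
Local Notation e := (@vtx k n n_ge3).

Lemma XY_comm : X * Y = Y * X.
Proof.
rewrite /sum_alpha /sum_alpha_star -!rmorphM; apply/quot_piP; rewrite -OmegaE.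
exact: ideal_gen_id.
Qed.

Lemma vtxX i : e i * X = alpha k n_ge3 i.
Proof. by rewrite /vtx /sum_alpha -rmorphM ptriv_PX. Qed.
Lemma Xvtx i : X * e (ordS i) = alpha k n_ge3 i.
Proof. by rewrite /vtx /sum_alpha -rmorphM PX_ptriv. Qed.
Lemma vtxY i : e (ordS i) * Y = alpha_star k n_ge3 i.
Proof. by rewrite /vtx /sum_alpha_star -rmorphM ptriv_PY. Qed.
Lemma Yvtx i : Y * e i = alpha_star k n_ge3 i.
Proof. by rewrite /vtx /sum_alpha_star -rmorphM PY_ptriv. Qed.

Lemma sum_vtx : \sum_i e i = 1.
Proof. by rewrite -raddf_sum /= -[RHS](rmorph1 pi). Qed.

(** Substitution of X and Y in a polynomial.  R is not commutative, so that ev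
    is multiplicative only because X and Y commute; the powers of Y are put on
    the left. *)
Definition ev (P : S) : R := (map_poly (horner_alg Y) P).[X].

Fact ev_additive : zmod_morphism ev.
Proof. by move=> P P'; rewrite /ev rmorphB hornerD hornerN. Qed.
HB.instance Definition _ :=
  GRing.isZmodMorphism.Build S R ev ev_additive.

Lemma ev1 : ev 1 = 1.
Proof. by rewrite /ev rmorph1 hornerC. Qed.

Lemma evZ c P : ev (c%:P%:P * P) = c *: ev P.
Proof.
by rewrite /ev rmorphM /= map_polyC /= horner_algC mul_polyC hornerZ mulr_algl.
Qed.

Lemma ev_mulX P : ev (P * 'X) = ev P * X.
Proof. by rewrite /ev rmorphM /= map_polyX hornerMX. Qed.

Lemma ev_mulY P : ev (P * 'X%:P) = ev P * Y.
Proof.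
rewrite /ev rmorphM /= map_polyC /= horner_algX hornerM_comm ?hornerC //.
by rewrite /comm_poly hornerC XY_comm.
Qed.

(** Each arrow is an idempotent times X or Y, and this idempotent is
    absorbed by the part of the path before it. *)
Lemma pi_path p : pi (pbasis k p) = e (qstart p) * ev (path_wt p).
Proof.
case: p => [[v s] /= vs]; elim/last_ind: s vs => [|s a IH] vs.
  rewrite /path_wt big_nil ev1 mulr1 /vtx /ptriv; congr (pi (pbasis k _)).
  exact: qpath_eq.
have /andP[sP /andP[/eqP aP _]] :
    is_qpath v s && is_qpath (qpath_end v s) [:: a].
  by rewrite -is_qpath_cat cats1.
pose p : qpath Q := @QPath Q (v, s) sP.
set p1 := QPath _.
have pE : pbasis k p * ptriv k (qsrc a) = pbasis k p.
  by rewrite /ptriv pbasisM /pbasis_mul qconcat_trivr aP eqxx.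
have -> : pbasis k p1 = pbasis k p * parrow k a.
  rewrite /parrow pbasisM /pbasis_mul.
  case: qconcatP => [r _ rs ra _|]; last first.
    by move=> /negP[]; apply/eqP; exact: esym aP.
  by congr pbasis; apply: qpath_eq; rewrite ?rs // ra cats1.
have -> : path_wt p1 = path_wt p * arrow_wt a.
  by rewrite /path_wt /qarrows /= -cats1 big_cat big_seq1.
have -> : qstart p1 = v by [].
clear p1 vs; case: a aP pE => i _ pE.
  rewrite -[parrow _ _]ptriv_PX mulrA pE rmorphM /= IH -/p /= -mulrA.
  by congr (_ * _); rewrite ev_mulX.
rewrite -[parrow _ _]ptriv_PY mulrA pE rmorphM /= IH -/p /= -mulrA.
by congr (_ * _); rewrite ev_mulY.
Qed.

(** The coordinates factor through R by [coord_pi]; as they also determine the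
    elements of R, questions about right multiplication by X and Y in R become
    questions about polynomials. *)
Lemma pi_coord f : pi f = \sum_l e l * ev (coord l f).
Proof.
elim/path_alg_ind: f => [|f g IHf IHg|c f IH|p].
- by rewrite raddf0 big1 // => l _; rewrite !raddf0 mulr0.
- rewrite raddfD /= IHf IHg -big_split; apply: eq_bigr => l _.
  by rewrite !raddfD /= mulrDr.
- rewrite linearZ /= IH scaler_sumr; apply: eq_bigr => l _.
  by rewrite coordZ evZ scalerAr.
rewrite pi_path.
under eq_bigr => l _ do rewrite coord_basis.
rewrite (bigD1 (qstart p)) //= eqxx big1 ?addr0 // => l /negPf nl.
by rewrite [qstart p == _]eq_sym nl raddf0 mulr0.
Qed.

Lemma pi_coord0 f : (forall l, coord l f = 0) -> pi f = 0.
Proof.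
by move=> f0; rewrite pi_coord big1 // => l _; rewrite f0 raddf0 mulr0.
Qed.

Lemma sum_alpha_regular r : r * X = 0 -> r = 0.
Proof.
case: (quot_pi_surj r) => f <- fX0; apply: pi_coord0 => l.
have /(coord_pi l) : pi (f * PX) = pi 0 by rewrite rmorphM raddf0.
rewrite (coordMr coordX) raddf0 => /eqP.
by rewrite mulf_eq0 polyX_eq0 orbF => /eqP.
Qed.

Lemma sum_alpha_star_regular r : r * Y = 0 -> r = 0.
Proof.
case: (quot_pi_surj r) => f <- fY0; apply: pi_coord0 => l.
have /(coord_pi l) : pi (f * PY) = pi 0 by rewrite rmorphM raddf0.
rewrite (coordMr coordY) raddf0 => /eqP.
by rewrite mulf_eq0 polyC_eq0 polyX_eq0 orbF => /eqP.
Qed.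

Lemma coord_mulX l f a : coord l (f * PX ^+ a) = coord l f * 'X^a.
Proof.
by elim: a => [|a IH]; rewrite ?mulr1 // !exprSr !mulrA (coordMr coordX) IH.
Qed.

Lemma coord_mulY l f b : coord l (f * PY ^+ b) = coord l f * ('X^b)%:P.
Proof.
elim: b => [|b IH]; rewrite ?mulr1 // !exprSr mulrA (coordMr coordY) IH.
by rewrite rmorphM mulrA.
Qed.

Lemma ev_mulXn P a : ev (P * 'X^a) = ev P * X ^+ a.
Proof. by elim: a => [|a IH]; rewrite ?mulr1 // !exprSr !mulrA ev_mulX IH. Qed.

(** On coordinates this is the coprimality of x^a and y^b in k[x,y], applied
    vertex by vertex: y^b does not change the x-degree, so the coordinates of r
    have no coefficient of x-degree below a. *)
Lemma sum_alpha_coprime (r t : R) a b :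
  r * Y ^+ b = t * X ^+ a -> exists h, r = h * X ^+ a.
Proof.
case: (quot_pi_surj r) (quot_pi_surj t) => f <- [g <-] e1.
have eq_pi : pi (f * PY ^+ b) = pi (g * PX ^+ a) by rewrite !rmorphM !rmorphXn.
exists (\sum_l e l * ev (drop_poly a (coord l f))).
rewrite -[LHS]/(pi f) pi_coord mulr_suml; apply: eq_bigr => l _.
rewrite -mulrA -ev_mulXn; congr (_ * ev _).
rewrite -[LHS](poly_take_drop a).
suff -> : take_poly a (coord l f) = 0 by rewrite add0r.
apply/polyP => i; rewrite coef_take_poly coef0; case: ltnP => // lt_ia.
have /(congr1 (fun P : S => P`_i)) := coord_pi l eq_pi.
rewrite coord_mulY coord_mulX coefMC coefMXn lt_ia => /eqP.
by rewrite mulf_eq0 expf_eq0 polyX_eq0 andbF orbF => /eqP.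
Qed.

Lemma vtx_neq0 i : e i != 0.
Proof.
apply/eqP => e0; have /(coord_pi i) : pi (ptriv k (i : qvert Q)) = pi 0.
  by rewrite [RHS]raddf0.
rewrite raddf0 /ptriv coord_basis /= eqxx /path_wt big_nil => /eqP.
by rewrite oner_eq0.
Qed.

Lemma preproj_ind (P : R -> Prop) :
  P 0 -> (forall r t, P r -> P t -> P (r + t)) ->
  (forall c r, P r -> P (c *: r)) -> (forall i, P (e i)) ->
  (forall r, P r -> P (r * X)) -> (forall r, P r -> P (r * Y)) ->
  forall r, P r.
Proof.
move=> P0 PD PZ Pe PmX PmY r; case: (quot_pi_surj r) => f <-.
rewrite -[quot_pi _ _]/(pi f).
elim/path_alg_ind: f => [|f g Pf Pg|c f Pf|p].
- by rewrite raddf0.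
- by rewrite raddfD; apply: PD.
- by rewrite linearZ; apply: PZ.
rewrite pi_path /path_wt; elim/last_ind: (qarrows p) => [|s a IH].
  by rewrite big_nil ev1 mulr1.
rewrite -cats1 big_cat big_seq1; case: a => i /=.
  by rewrite ev_mulX mulrA; apply: PmX.
by rewrite ev_mulY mulrA; apply: PmY.
Qed.

Lemma XY_central r : X * Y * r = r * (X * Y).
Proof.
elim/preproj_ind: r => [|r t IHr IHt|c r IH|i|r IH|r IH].
- by rewrite mulr0 mul0r.
- by rewrite mulrDr mulrDl IHr IHt.
- by rewrite -scalerAr IH scalerAl.
- by rewrite -mulrA Yvtx -vtxY mulrA Xvtx -vtxX mulrA.
- by rewrite mulrA IH -!mulrA -XY_comm.
- by rewrite mulrA IH -!mulrA; congr (_ * _); rewrite !mulrA XY_comm.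
Qed.

End NormalForm.

(** * Walks around the cycle and orders of roots of unity *)

Lemma scaler_inj_vec (k : fieldType) (V : lmodType k) (v : V) :
  v != 0 -> injective (fun c : k => c *: v).
Proof.
move=> v0 c d /= /eqP; rewrite -subr_eq0 -scalerBl scaler_eq0 (negPf v0) orbF.
by rewrite subr_eq0 => /eqP.
Qed.

Section CyclicIndices.
Variable n : nat.
Implicit Types i j : 'I_n.

Lemma val_iter_ordS t i : iter t (@ordS n) i = ((i + t) %% n)%N :> nat.
Proof.
elim: t => [|t IH]; first by rewrite addn0 modn_small.
by rewrite /= IH -addn1 modnDml addn1 addnS.
Qed.

Lemma iter_ordS_period q i : iter (n * q) (@ordS n) i = i.
Proof.
by apply: val_inj; rewrite /= val_iter_ordS addnC mulnC modnMDl modn_small.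
Qed.

Lemma iter_ordS_trans i j : exists t, iter t (@ordS n) i = j.
Proof.
exists (j + n - i)%N; apply: val_inj; rewrite /= val_iter_ordS subnKC.
  by rewrite modnDr modn_small.
exact: leq_trans (ltnW (ltn_ord i)) (leq_addl _ _).
Qed.

Variables (k : fieldType) (xi : 'I_n -> k).

(** The scalar by which a diagonal automorphism acts on the path made of the a
    nonstar arrows that follow the vertex i. *)
Definition walk_prod (a : nat) i : k := \prod_(t < a) xi (iter t (@ordS n) i).

Lemma walk_prodS a i :
  walk_prod a.+1 i = walk_prod a i * xi (iter a (@ordS n) i).
Proof. exact: big_ord_recr. Qed.

Lemma walk_prodD a b i :
  walk_prod (a + b) i = walk_prod a i * walk_prod b (iter a (@ordS n) i).
Proof.
rewrite /walk_prod big_split_ord; congr (_ * _); apply: eq_bigr => t _ /=.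
by rewrite addnC iterD.
Qed.

Lemma walk_prod_turn i : walk_prod n i = \prod_j xi j.
Proof.
rewrite [RHS](reindex_inj (h := fun t : 'I_n => iter t (@ordS n) i)) //.
move=> t u /(congr1 val) /=; rewrite !val_iter_ordS => /eqP.
by rewrite eqn_modDl !modn_small // => /eqP/val_inj.
Qed.

Lemma walk_prod_turns q i : walk_prod (n * q) i = (\prod_j xi j) ^+ q.
Proof.
elim: q => [|q IH]; first by rewrite muln0 /walk_prod big_ord0.
rewrite mulnS walk_prodD walk_prod_turn exprS -IH.
by have := iter_ordS_period 1 i; rewrite muln1 => ->.
Qed.

End CyclicIndices.

Lemma root_order_prim (k : fieldType) (z : k) m :
  (0 < m)%N -> z ^+ m = 1 -> (root_order z).-primitive_root z.
Proof.
move=> m0 zm; have [|o0 /eqP zo omin] := @least_posP (fun d => z ^+ d == 1).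
  by exists m; rewrite m0 zm eqxx.
have [d zd d_o] := prim_order_exists o0 zo.
rewrite (_ : root_order z = d) //; apply/eqP; rewrite eqn_leq omin.
- by rewrite dvdn_leq.
- exact: prim_order_gt0 zd.
- by rewrite (prim_expr_order zd).
Qed.

(** Raising the product to the power N, the product of the orders of the other
    factors, kills every factor but z_i; as N is prime to the order of z_i, it
    can be cancelled. *)
Lemma prod_coprime_orders (k : fieldType) (I : finType) (z : I -> k) m d :
  (0 < m)%N -> (forall i, z i ^+ m = 1) ->
  (forall i j, i != j -> coprime (root_order (z i)) (root_order (z j))) ->
  (\prod_i z i) ^+ d = 1 -> forall i, z i ^+ d = 1.
Proof.
move=> m0 zm cop Pd i; have zP j := root_order_prim m0 (zm j).
pose N := (\prod_(j | j != i) root_order (z j))%N.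
have cN : coprime (root_order (z i)) N.
  rewrite /N; elim/big_rec: _ => [|j x ji cx]; first exact: coprimen1.
  by rewrite coprimeMr cx cop // eq_sym.
apply/eqP; rewrite -(prim_order_dvd (zP i)) -(Gauss_dvdl d cN).
rewrite (prim_order_dvd (zP i)); have := congr1 (fun y => y ^+ N) Pd.
rewrite expr1n -exprM -prodrXl (bigD1 i) //= big1 ?mulr1 => [->//|j ji].
apply/eqP; rewrite -(prim_order_dvd (zP j)) dvdn_mull //.
by rewrite /N (bigD1 j) //= dvdn_mulr.
Qed.

(** * Automorphisms that scale the arrows *)

Lemma aut_eigenM (k : fieldType) (A : algType k) (g : algAut A) u v c d :
  g u = c *: u -> g v = d *: v -> g (u * v) = (c * d) *: (u * v).
Proof.
by move=> gu gv; rewrite rmorphM /= gu gv -scalerAl -scalerAr scalerA.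
Qed.

Section DiagonalAut.
Variables (k : fieldType) (n : nat) (n_ge3 : (3 <= n)%N).
Local Notation R := (preproj k n_ge3).
Local Notation e := (@vtx k n n_ge3).
Local Notation X := (sum_alpha k n_ge3).
Local Notation Y := (sum_alpha_star k n_ge3).
Implicit Types (i j : 'I_n).

Lemma vtx_idem i : e i * e i = e i.
Proof.
rewrite /vtx -rmorphM /ptriv pbasisM /pbasis_mul qconcat_trivl.
by rewrite /qstart /= eqxx.
Qed.

Lemma vtxXn i a : e i * X ^+ a = X ^+ a * e (iter a (@ordS n) i).
Proof.
elim: a => [|a IH]; first by rewrite mulr1 mul1r.
by rewrite exprSr mulrA IH -!mulrA vtxX /= Xvtx.
Qed.

Lemma vtxYn i a : e (iter a (@ordS n) i) * Y ^+ a = Y ^+ a * e i.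
Proof.
elim: a => [|a IH]; first by rewrite mulr1 mul1r.
by rewrite exprS mulrA vtxY -Yvtx -!mulrA IH.
Qed.

Lemma aut_eq1 (g : algAut R) : (forall i, g (e i) = e i) ->
  (forall i, g (alpha k n_ge3 i) = alpha k n_ge3 i) ->
  (forall i, g (alpha_star k n_ge3 i) = alpha_star k n_ge3 i) -> g = 1%g.
Proof.
move=> ge gx gy.
have gX : g X = X.
  rewrite -[X]mul1r -sum_vtx mulr_suml raddf_sum.
  by apply: eq_bigr => i _; rewrite vtxX; apply: gx.
have gY : g Y = Y.
  rewrite -[Y]mulr1 -sum_vtx mulr_sumr raddf_sum.
  by apply: eq_bigr => i _; rewrite Yvtx; apply: gy.
apply: algAut_eq => r; rewrite algAut1E.
elim/preproj_ind: r => [|r t IHr IHt|c r IH|i|r IH|r IH].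
- by rewrite raddf0.
- by rewrite raddfD /= IHr IHt.
- by rewrite linearZ /= IH.
- exact: ge.
- by rewrite rmorphM /= IH gX.
- by rewrite rmorphM /= IH gY.
Qed.

Lemma alphaM i : alpha k n_ge3 i * alpha_star k n_ge3 i = e i * X * Y.
Proof.
by rewrite -vtxX -Yvtx -mulrA [X * (_ * _)]mulrA XY_central !mulrA vtx_idem.
Qed.

Lemma alphaM_neq0 i : alpha k n_ge3 i * alpha_star k n_ge3 i != 0.
Proof.
rewrite alphaM; apply/eqP => /sum_alpha_star_regular/sum_alpha_regular/eqP.
by rewrite (negPf (vtx_neq0 k n_ge3 i)).
Qed.

Variables (s : algAut R) (xi xi_star : 'I_n -> k).
Hypothesis s_vtx : forall i, s (e i) = e i.
Hypothesis s_alpha : forall i, s (alpha k n_ge3 i) = xi i *: alpha k n_ge3 i.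
Hypothesis s_alpha_star :
  forall i, s (alpha_star k n_ge3 i) = xi_star i *: alpha_star k n_ge3 i.

Lemma s_alphaM i : s (alpha k n_ge3 i * alpha_star k n_ge3 i) =
  (xi i * xi_star i) *: (alpha k n_ge3 i * alpha_star k n_ge3 i).
Proof. exact: aut_eigenM. Qed.

(** The loop XY at the vertex i + 1 is both alpha_(i+1) alpha_(i+1)^* and
    alpha_i^* alpha_i. *)
Lemma xi_prod_const i j : xi i * xi_star i = xi j * xi_star j.
Proof.
have [t <-] := iter_ordS_trans i j; elim: t => //= t ->.
set l := iter t _ i; apply: (scaler_inj_vec (alphaM_neq0 (ordS l))).
rewrite /= -s_alphaM.
have e1 : alpha_star k n_ge3 l * alpha k n_ge3 l =
    alpha k n_ge3 (ordS l) * alpha_star k n_ge3 (ordS l).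
  rewrite -vtxY -Xvtx -vtxX -Yvtx -!mulrA; congr (_ * _).
  by rewrite !mulrA XY_comm.
by rewrite -e1 mulrC; apply/esym/aut_eigenM.
Qed.

Hypothesis xi_unit : forall i, xi i * xi_star i = 1.

Lemma s_XY : s (X * Y) = X * Y.
Proof.
rewrite -[X * Y]mul1r -sum_vtx mulr_suml raddf_sum; apply: eq_bigr => i _ /=.
by rewrite mulrA -alphaM s_alphaM xi_unit scale1r.
Qed.

Lemma s_vtxXn i a : s (e i * X ^+ a) = walk_prod xi a i *: (e i * X ^+ a).
Proof.
elim: a => [|a IH]; first by rewrite mulr1 s_vtx /walk_prod big_ord0 scale1r.
have -> : e i * X ^+ a.+1 = e i * X ^+ a * alpha k n_ge3 (iter a (@ordS n) i).
  rewrite -vtxX [RHS]mulrA exprSr mulrA vtxXn.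
  by rewrite -[X ^+ a * _ * e _]mulrA vtx_idem.
by rewrite walk_prodS; apply: aut_eigenM IH (s_alpha _).
Qed.

Lemma s_vtxYn i a : s (e (iter a (@ordS n) i) * Y ^+ a) =
  (walk_prod xi a i)^-1 *: (e (iter a (@ordS n) i) * Y ^+ a).
Proof.
elim: a => [|a IH].
  by rewrite mulr1 s_vtx /walk_prod big_ord0 invr1 scale1r.
set l := iter a (@ordS n) i in IH *.
have -> : e (iter a.+1 (@ordS n) i) * Y ^+ a.+1 =
    alpha_star k n_ge3 l * (e l * Y ^+ a).
  rewrite exprS mulrA vtxY -Yvtx -!mulrA; congr (_ * _).
  by rewrite mulrA vtx_idem.
suff <- : xi_star l * (walk_prod xi a i)^-1 = (walk_prod xi a.+1 i)^-1.
  exact: aut_eigenM (s_alpha_star _) IH.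
rewrite walk_prodS invfM mulrC; congr (_ * _); rewrite -/l.
have xl0 : xi l != 0.
  by apply: contra_eq_neq (xi_unit l) => ->; rewrite mul0r eq_sym oner_eq0.
by apply: (mulfI xl0); rewrite xi_unit divff.
Qed.

Hypothesis (s_fin : finite_order s).
Local Notation m := (group_order s).

Lemma xi_order i : xi i ^+ m = 1.
Proof.
have /eqP := eigen_expg m (s_alpha i); rewrite expg_group_order // algAut1E.
rewrite -{1}[alpha _ _ _]scale1r -subr_eq0 -scalerBl scaler_eq0.
case/orP => [|/eqP a0]; first by rewrite subr_eq0 => /eqP.
by have := alphaM_neq0 i; rewrite a0 mul0r eqxx.
Qed.

Lemma xi_exp_ge d : (0 < d)%N -> (forall i, xi i ^+ d = 1) -> (m <= d)%N.
Proof.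
move=> d0 xd; apply: group_order_le => //; apply: aut_eq1 => i.
- exact: aut_expg_fix.
- by rewrite (eigen_expg d (s_alpha i)) xd scale1r.
rewrite (eigen_expg d (s_alpha_star i)).
have := congr1 (fun y => y ^+ d) (xi_unit i).
by rewrite exprMn xd mul1r expr1n => ->; rewrite scale1r.
Qed.

Lemma prod_xi_prim :
  (forall i j, i != j -> coprime (root_order (xi i)) (root_order (xi j))) ->
  m.-primitive_root (\prod_i xi i).
Proof.
move=> cop; have m0 := group_order_gt0 s_fin.
have Pm : (\prod_i xi i) ^+ m = 1.
  by rewrite -prodrXl big1 // => i _; apply: xi_order.
have [d Pd d_m] := prim_order_exists m0 Pm.
suff -> : m = d by [].
apply/eqP; rewrite eqn_leq (dvdn_leq m0 d_m) andbT.
apply: xi_exp_ge (prim_order_gt0 Pd) _.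
exact: prod_coprime_orders m0 xi_order cop (prim_expr_order Pd).
Qed.

(** It is enough to reach every power of zeta by walks along X: completing a
    walk to a multiple of m turns gives one of inverse weight that ends at i,
    and its reverse is the eigenvector along Y that [auslander_bij] asks
    for. *)
Lemma auslander_bij_of_walks (zeta : k) :
  m.-primitive_root zeta -> m%:R != 0 :> k ->
  (\prod_i xi i) ^+ m = 1 ->
  (forall i (j : nat), exists a, walk_prod xi a i = zeta ^+ j) ->
  bijective (auslander (cycle_group s_fin)).
Proof.
move=> zP m_neq0 Pm walk.
apply: (auslander_bij s_fin zP m_neq0 (sum_vtx k n_ge3) vtx_idem s_vtx
  (XY_comm _ _) (@XY_central _ _ _) s_XY (@sum_alpha_regular _ _ _)
  (@sum_alpha_star_regular _ _ _) (@sum_alpha_coprime _ _ _)) => i j.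
have [a wa] := walk i j; split.
  exists a, (iter a (@ordS n) i).
  split; [exact: vtxXn | exact: vtxYn | |].
    by rewrite -wa; apply: s_vtxXn.
  by rewrite -wa; apply: s_vtxYn.
(* going on from the end of the walk of length a, up to a whole number of
   turns of trivial weight, gives the walk whose reverse is e_i Y^b *)
pose b := (n * (m * a) - a)%N; exists b.
have le_a : (a <= n * (m * a))%N.
  rewrite mulnA leq_pmull // muln_gt0 (group_order_gt0 s_fin).
  by rewrite (leq_trans _ n_ge3).
pose i' := iter a (@ordS n) i.
have i'b : iter b (@ordS n) i' = i.
  by rewrite /i' -iterD subnK // iter_ordS_period.
have : walk_prod xi a i * walk_prod xi b i' = 1.
  by rewrite -walk_prodD subnKC // walk_prod_turns exprM Pm expr1n.
move=> walk1; suff <- : (walk_prod xi b i')^-1 = zeta ^+ j.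
  by have := s_vtxYn i' b; rewrite i'b.
rewrite -wa -[LHS]mul1r -walk1 mulfK //; apply: contra_eq_neq walk1 => ->.
by rewrite mulr0 eq_sym oner_eq0.
Qed.

End DiagonalAut.

Theorem theorem2p8 (k : closedFieldType) (k_char0 : [pchar k] =i pred0)
    (n : nat) (n_ge3 : (3 <= n)%N)
    (s : algAut (preproj k n_ge3)) (sF : finite_graded_aut s)
    (m : nat) (ord_s : group_order s = m) (m_gt1 : (1 < m)%N)
    (xi xi_star : 'I_n -> k)
    (xi_neq0 : forall i, xi i != 0) (xi_star_neq0 : forall i, xi_star i != 0)
    (s_alpha : forall i, s (alpha k n_ge3 i) = xi i *: alpha k n_ge3 i)
    (s_alpha_star : forall i,
       s (alpha_star k n_ge3 i) = xi_star i *: alpha_star k n_ge3 i)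
    (xi1 : xi (Ordinal (ltnW n_ge3)) * xi_star (Ordinal (ltnW n_ge3)) = 1) :
  [\/ exists2 zeta : k, m.-primitive_root zeta & forall i, xi i = zeta,
      exists2 zeta : k, m.-primitive_root zeta & \prod_(i < n) xi i = zeta
    | forall i j : 'I_n, i != j ->
        coprime (root_order (xi i)) (root_order (xi j))] ->
  let G := cycle_group (finite_graded_aut_order sF) in
  bijective (auslander G : {rmorphism skew_ring G -> fixed_endo G}).
Proof.
subst m => cases G; have [_ s_fin s_vtx] := sF.
have xi_unit i : xi i * xi_star i = 1.
  by rewrite -xi1; apply: xi_prod_const s_alpha s_alpha_star _ _.
have m_neq0 : (group_order s)%:R != 0 :> k.
  by rewrite ((pcharf0P k).1 k_char0) -lt0n ltnW.
have from_walks := auslander_bij_of_walks s_vtx s_alpha s_alpha_star xi_unit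
  (finite_graded_aut_order sF).
have from_turn : (group_order s).-primitive_root (\prod_i xi i) ->
    bijective (auslander G).
  move=> Pprim; apply: (from_walks _ Pprim m_neq0) => [|i j].
    exact: prim_expr_order.
  by exists (n * j)%N; rewrite walk_prod_turns.
case: cases => [[zeta]|[zeta]|cop].
- move=> zeta_prim xiE.
  apply: (from_walks _ zeta_prim m_neq0) => [|i j].
    rewrite -prodrXl big1 // => i _.
    by rewrite xiE (prim_expr_order zeta_prim).
  exists j; rewrite /walk_prod; under eq_bigr do rewrite xiE.
  by rewrite prodr_const card_ord.
- by move=> zeta_prim PE; apply: from_turn; rewrite PE.
exact/from_turn/(prod_xi_prim s_vtx s_alpha s_alpha_star).
Qed.
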